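(* There exist an integer $d>1$, a holomorphic family $f_t$ ($t\in\mathbb{D}^*$) of rational maps on $\mathbb{P}^1=\mathbb{P}^1(\mathbb{C})$ of degree $d$ whose coefficients extend to meromorphic functions on $\mathbb{D}$, and a holomorphic map $a:\mathbb{D}\to\mathbb{P}^1$, such that $$\limsup_{t\to 0} g_{f,a}(t)=-\infty .$$ In particular, $g_{f,a}$ need not be bounded from below near $t=0$ and need not extend continuously across $t=0$.
   Context: $\mathbb{D}=\{t\in\mathbb{C}:|t|<1\}$ and $\mathbb{D}^*=\{t\in\mathbb{C}:0<|t|<1\}$. Each $f_t$, $t\in\mathbb{D}^*$, has degree exactly $d$. Definition of $g_{f,a}$. Choose a family of homogeneous polynomial maps $\tilde f_t:\mathbb{C}^2\to\mathbb{C}^2$ of degree $d$, with coefficients holomorphic functions of $t$ on all of $\mathbb{D}$, such that for every $t\in\mathbb{D}^*$, $\tilde f_t^{-1}(0,0)=\{(0,0)\}$ and $\tilde f_t$ projects to $f_t$ on $\mathbb{P}^1$. Choose a holomorphic lift $\tilde a:\mathbb{D}\to\mathbb{C}^2\setminus\{(0,0)\}$ of $a$. The escape rate is $$G_{\tilde f}(t,(z,w))=\lim_{n\to\infty}\frac1{d^n}\log\|\tilde f_t^n(z,w)\|,\qquad t\in\mathbb{D}^*,\ (z,w)\in\mathbb{C}^2\setminus\{(0,0)\},$$ for any norm $\|\cdot\|$ on $\mathbb{C}^2$. It is known that there is a unique $\eta\in\mathbb{R}$ such that the function $g_{f,a}(t):=G_{\tilde f}(t,\tilde a(t))-\eta\log|t|$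 on $\mathbb{D}^*$ satisfies $g_{f,a}(t)=o(\log|t|)$ as $t\to0$; this defines $g_{f,a}$, which is continuous and subharmonic on $\mathbb{D}^*$. The function $g_{f,a}$ depends on the choices of $\tilde f$ and $\tilde a$ only up to addition of a harmonic function on $\mathbb{D}^*$ that is bounded near $t=0$. *)

(* Defs.v *)
From Stdlib Require Import Reals.
From Coquelicot Require Import Coquelicot.

Open Scope R_scope.

Definition disk (t : C) : Prop := Cmod t < 1.

Definition pdisk (t : C) : Prop := 0 < Cmod t < 1.

(* [ex_derive] here is complex differentiability; the sets [U] used below
   ([disk] and [pdisk]) are open. *)
Definition holomorphic_on (U : C -> Prop) (c : C -> C) : Prop :=
  forall t : C, U t -> ex_derive (K := C_AbsRing) (V := C_NormedModule) c t.

(* A holomorphic function on the punctured disk which extends to a meromorphic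
   function on the disk, i.e. has at worst a pole at 0. *)
Definition meromorphic_at_0 (c : C -> C) : Prop :=
  holomorphic_on pdisk c /\
  exists (N : nat) (h : C -> C), holomorphic_on disk h /\
    forall t : C, pdisk t -> (h t = Cpow t N * c t)%C.

Inductive P1 : Type :=
| Fin (z : C)
| Infty.

(* The canonical projection, sending [(z, w)] to [z : w]; the value at [(0, 0)]
   is meaningless. *)
Definition proj (u : C * C) : P1 :=
  if Ceq_dec (snd u) 0 then Infty else Fin (fst u / snd u)%C.

(* The two standard charts; their values at [Infty], resp. at [Fin 0], are
   meaningless. *)
Definition chart (x : P1) : C :=
  match x with Fin z => z | Infty => RtoC 0 end.

Definition chart_infty (x : P1) : C :=
  match x with Fin z => (/ z)%C | Infty => RtoC 0 end.

Definition holomorphic_P1 (a : C -> P1) : Prop :=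
  forall t : C, disk t ->
    (locally t (fun s => a s <> Infty) /\
     ex_derive (K := C_AbsRing) (V := C_NormedModule) (fun s => chart (a s)) t)
    \/
    (locally t (fun s => a s <> Fin 0) /\
     ex_derive (K := C_AbsRing) (V := C_NormedModule)
       (fun s => chart_infty (a s)) t).

(* The binary form of degree [d] in which [p i] is the coefficient of
   [z ^ i * w ^ (d - i)]. *)
Definition form (d : nat) (p : nat -> C) (u : C * C) : C :=
  sum_n (fun i => (p i * (Cpow (fst u) i * Cpow (snd u) (d - i)))%C) d.

Definition form_map (d : nat) (p q : nat -> C) (u : C * C) : C * C :=
  (form d p u, form d q u).

Definition C2_zero : C * C := (RtoC 0, RtoC 0).

Definition nondegenerate (F : C * C -> C * C) : Prop :=
  forall u : C * C, F u = C2_zero <-> u = C2_zero.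

Definition projects_to (F : C * C -> C * C) (phi : P1 -> P1) : Prop :=
  forall u : C * C, u <> C2_zero -> phi (proj u) = proj (F u).

(* For [t] in the punctured disk, [f t] is a rational map of degree exactly [d]:
   two binary forms of degree [d] have no common factor iff their only common
   zero is the origin. *)
Definition meromorphic_family (d : nat) (f : C -> P1 -> P1) : Prop :=
  exists p q : nat -> C -> C,
    (forall i : nat, (i <= d)%nat ->
       meromorphic_at_0 (p i) /\ meromorphic_at_0 (q i)) /\
    (forall t : C, pdisk t ->
       nondegenerate (form_map d (fun i => p i t) (fun i => q i t)) /\
       projects_to (form_map d (fun i => p i t) (fun i => q i t)) (f t)).

Definition family_lift (d : nat) (f : C -> P1 -> P1)
    (F : C -> C * C -> C * C) : Prop :=
  exists p q : nat -> C -> C,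
    (forall i : nat, (i <= d)%nat ->
       holomorphic_on disk (p i) /\ holomorphic_on disk (q i)) /\
    (forall t : C, F t = form_map d (fun i => p i t) (fun i => q i t)) /\
    (forall t : C, pdisk t -> nondegenerate (F t) /\ projects_to (F t) (f t)).

Definition point_lift (a : C -> P1) (b : C -> C * C) : Prop :=
  holomorphic_on disk (fun t => fst (b t)) /\
  holomorphic_on disk (fun t => snd (b t)) /\
  (forall t : C, disk t -> b t <> C2_zero /\ proj (b t) = a t).

Definition C2_norm (u : C * C) : R :=
  norm (u : prod_NormedModule C_AbsRing C_NormedModule C_NormedModule).

Definition is_escape_rate (d : nat) (F : C * C -> C * C) (u : C * C) (G : R)
    : Prop :=
  is_lim_seq (fun n => ln (C2_norm (Nat.iter n F u)) / INR d ^ n) G.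

(* [g] is one of the functions g_{f,a}: it is determined by [f] and [a] only up
   to the choice of the lifts [F] and [b]; [eta] is determined by [F] and [b].
   The last condition is g(t) = o(log|t|) as t -> 0.  Values of [g] outside the
   punctured disk are irrelevant. *)
Definition is_g (d : nat) (f : C -> P1 -> P1) (a : C -> P1) (g : C -> R)
    : Prop :=
  exists (F : C -> C * C -> C * C) (b : C -> C * C) (eta : R),
    family_lift d f F /\ point_lift a b /\
    (forall t : C, pdisk t ->
       is_escape_rate d (F t) (b t) (g t + eta * ln (Cmod t))) /\
    is_domin (U := R_NormedModule) (V := R_NormedModule)
      (locally' (RtoC 0 : C_UniformSpace)) (fun t : C => ln (Cmod t)) g.

(* The infimum, over the sets [A] of the filter, of the supremum of [g] on
   [A]. *)
Definition limsup {T : Type} (Flt : (T -> Prop) -> Prop) (g : T -> R) : Rbar :=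
  Rbar_glb (fun s => exists A : T -> Prop,
    Flt A /\ s = Lub_Rbar (fun y => exists t : T, A t /\ y = g t)).

Definition bounded_below_near_0 (g : C -> R) : Prop :=
  exists M : R, locally' (RtoC 0 : C_UniformSpace) (fun t => M <= g t).

Definition extends_continuously_at_0 (g : C -> R) : Prop :=
  exists h : C -> R, (forall t : C, pdisk t -> h t = g t) /\
    continuous (U := R_UniformSpace) h (RtoC 0 : C_UniformSpace).

(* Main.v *)
Require Import Defs.
From Stdlib Require Import Reals.
From Coquelicot Require Import Coquelicot.
From Stdlib Require Import ZArith Lra Lia Classical ClassicalEpsilon.

(** The family is
      F_t (z, w) = (lam z (z - w), w (z - w) + t z^2),   a = [lam : 1],
    with lam on the unit circle.  At t = 0 the two forms share the factor z - w,
    the hole of the degeneration, and what remains is the rotation z |-> lam z.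
    The orbit of a under that rotation never meets the hole z = w, but the
    angle of lam is a Liouville number, chosen so that the orbit approaches the hole so
    closely that
    2^(-n) log |F_0^n (lam, 1)| takes arbitrarily negative values
    ([exists_liouville_multiplier], [rotation_orbit_0], [hole_factor]).

    For |t| <= 1, in the max norm, |F_t u| <= 3 |u|^2 and |t| |u|^2 <= 8 |F_t u|.
    Hence the escape rate G(t) of (lam, 1) is at most
    2^(-n) (log |F_t^n (lam, 1)| + log 3) and at least
    2^(-n) (log |F_t^n (lam, 1)| - log 8 + log |t|), for every n.  As
    F_t^n (lam, 1) is continuous in t, with a nonzero value at t = 0, the upper
    bound gives G(t) -> -oo ([rotation_escape_minus_infty]) and the lower bound
    gives G(t) = o(log |t|) ([rotation_escape_little_o]).  So G is one of the
    functions g attached to the family and the point, with eta = 0.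

    Every other choice of lifts is h F and c (lam, 1), with h, c holomorphic on
    the disk, c without zeros and h without zeros outside 0
    ([rotation_lift_unique]).  It leads to
    g = G + log |h| + log |c| - eta log |t|, where g = o(log |t|).  So
    |h| <= |t|^(eta - eps) near 0 for every eps > 0, and it must be deduced that
    |h| = O(|t|^eta).  This is [growth_at_puncture], a consequence of the maximum
    principle for h(e^z) e^(-s z) on a half plane.  Holomorphic functions are here
    only assumed to be differentiable at each point, so the maximum
    principle is derived from Goursat's theorem ([goursat_rectangle]) and the
    mean value property on circles ([mean_value]). *)

(** * Bisection of rectangles *)
Definition bisection_stable (T : R -> R -> R -> R -> Prop) : Prop :=
  forall a b c d, a <= b -> c <= d ->
    T a ((a + b) / 2) c ((c + d) / 2) -> T ((a + b) / 2) b c ((c + d) / 2) ->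
    T a ((a + b) / 2) ((c + d) / 2) d -> T ((a + b) / 2) b ((c + d) / 2) d ->
    T a b c d.

Definition quarter (p : bool * bool) (s : R * R * R * R) : R * R * R * R :=
  let '(a, b, c, d) := s in
  let m := (a + b) / 2 in let n := (c + d) / 2 in
  (if fst p then m else a, if fst p then b else m,
   if snd p then n else c, if snd p then d else n).

Definition on_rect (T : R -> R -> R -> R -> Prop) (s : R * R * R * R) : Prop :=
  let '(a, b, c, d) := s in T a b c d.

Lemma bad_quarter T : bisection_stable T -> forall s,
  on_rect (fun a b c d => a <= b /\ c <= d /\ ~ T a b c d) s ->
  exists p, on_rect (fun a b c d => a <= b /\ c <= d /\ ~ T a b c d) (quarter p s).
Proof.
intros HT [[[a b] c] d] [Hab [Hcd HnT]].
apply NNPP; intro Hn; apply HnT; apply HT; auto; apply NNPP; intro Hq; apply Hn;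
 [exists (false, false)|exists (true, false)|exists (false, true)|exists (true, true)];
 simpl; repeat split; trivial; lra.
Qed.

Lemma nested_halves (a b : nat -> R) :
  (forall n, a n <= b n) -> (forall n, a n <= a (S n)) -> (forall n, b (S n) <= b n) ->
  exists x, forall n, a n <= x <= b n.
Proof.
intros Hab Ha Hb.
assert (Ha' : forall n m, (n <= m)%nat -> a n <= a m).
{ intros n m H; induction H; [lra|]. apply Rle_trans with (1 := IHle); apply Ha. }
assert (Hb' : forall n m, (n <= m)%nat -> b m <= b n).
{ intros n m H; induction H; [lra|]. apply Rle_trans with (2 := IHle); apply Hb. }
assert (Hcross : forall n m, a n <= b m).
{ intros n m. apply Rle_trans with (a (max n m)); [apply Ha'; lia|].
  apply Rle_trans with (b (max n m)); [apply Hab| apply Hb'; lia]. }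
destruct (completeness (fun y => exists n, y = a n)) as [x [Hx1 Hx2]].
- exists (b 0%nat); intros y [n ->]; apply Hcross.
- exists (a 0%nat), 0%nat; reflexivity.
- exists x; intro n; split.
  + apply Hx1; exists n; reflexivity.
  + apply Hx2; intros y [m ->]; apply Hcross.
Qed.

(** Cousin's lemma in the plane: a property of rectangles that passes from the
    four quarters to the whole, and that holds for all small rectangles around
    each point, holds globally.  Otherwise one could keep choosing a bad quarter,
    and small rectangles around the common point of the nested sequence would
    all be bad. *)
Lemma cousin_rectangle T a b c d : a <= b -> c <= d -> bisection_stable T ->
  (forall x y, a <= x <= b -> c <= y <= d -> exists delta, 0 < delta /\
     forall a' b' c' d', a <= a' <= x -> x <= b' <= b -> c <= c' <= y -> y <= d' <= d ->
       b' - a' < delta -> d' - c' < delta -> T a' b' c' d') ->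
  T a b c d.
Proof.
intros Hab Hcd HT Hloc.
apply NNPP; intro HnT.
set (Bad := on_rect (fun a b c d => a <= b /\ c <= d /\ ~ T a b c d)).
set (next := fun s => quarter (epsilon (inhabits (true, true))
                                 (fun p => Bad (quarter p s))) s).
set (s := fix s n := match n with O => (a, b, c, d) | S n => next (s n) end).
set (X1 := fun n => fst (fst (fst (s n)))). set (X2 := fun n => snd (fst (fst (s n)))).
set (Y1 := fun n => snd (fst (s n))). set (Y2 := fun n => snd (s n)).
assert (Hbad : forall n, Bad (s n)).
{ induction n; [simpl; auto|].
  change (Bad (next (s n))); unfold next.
  apply epsilon_spec, bad_quarter; assumption. }
assert (Hs : forall n, s n = (X1 n, X2 n, Y1 n, Y2 n)).
{ intro n; unfold X1, X2, Y1, Y2; destruct (s n) as [[[? ?] ?] ?]; reflexivity. }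
assert (Hord : forall n, X1 n <= X2 n /\ Y1 n <= Y2 n /\ ~ T (X1 n) (X2 n) (Y1 n) (Y2 n)).
{ intro n; generalize (Hbad n); rewrite Hs; trivial. }
assert (Hstep : forall n, (X1 n <= X1 (S n) /\ X2 (S n) <= X2 n /\
                           Y1 n <= Y1 (S n) /\ Y2 (S n) <= Y2 n) /\
   X2 (S n) - X1 (S n) = (X2 n - X1 n) / 2 /\ Y2 (S n) - Y1 (S n) = (Y2 n - Y1 n) / 2).
{ intro n.
  assert (HS : s (S n) = next (s n)) by reflexivity.
  revert HS; unfold next; rewrite (Hs (S n)).
  destruct (epsilon _ _) as [p q]; rewrite (Hs n); simpl.
  intros [= -> -> -> ->].
  destruct (Hord n) as [? [? _]].
  destruct p, q; lra. }
assert (Hw : forall n, X2 n - X1 n = (b - a) / 2 ^ n /\ Y2 n - Y1 n = (d - c) / 2 ^ n).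
{ induction n; [unfold X1, X2, Y1, Y2; simpl; lra|].
  destruct (Hstep n) as [_ [-> ->]]; destruct IHn as [-> ->].
  simpl; split; field; apply pow_nonzero; lra. }
destruct (nested_halves X1 X2) as [x Hx]; [intro n; apply Hord|intro n; apply Hstep..|].
destruct (nested_halves Y1 Y2) as [y Hy]; [intro n; apply Hord|intro n; apply Hstep..|].
destruct (Hloc x y (Hx 0%nat) (Hy 0%nat)) as [delta [Hdelta Hl]].
assert (Hmono : forall n, a <= X1 n /\ X2 n <= b /\ c <= Y1 n /\ Y2 n <= d).
{ induction n; [unfold X1, X2, Y1, Y2; simpl; lra|].
  destruct (Hstep n) as [? _]; lra. }
assert (Hsmall : exists n, (b - a + (d - c) + 1) / 2 ^ n < delta).
{ destruct (pow_lt_1_zero (/ 2) ltac:(rewrite Rabs_pos_eq; lra)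
     (delta / (b - a + (d - c) + 1))) as [N HN].
  { apply Rdiv_lt_0_compat; lra. }
  exists N. specialize (HN N (le_n N)).
  rewrite Rabs_pos_eq in HN by (apply pow_le; lra).
  unfold Rdiv; rewrite <- pow_inv.
  apply Rmult_lt_reg_r with (/ (b - a + (d - c) + 1)).
  - apply Rinv_0_lt_compat; lra.
  - field_simplify; [|lra..]. field_simplify in HN; [|lra]. lra. }
destruct Hsmall as [n Hn].
destruct (Hord n) as [H1 [H2 H3]].
apply H3; apply Hl; generalize (Hx n) (Hy n) (Hmono n) (Hw n);
  intros ? ? ? [Hw1 Hw2]; try lra.
- rewrite Hw1; apply Rle_lt_trans with (2 := Hn); apply Rmult_le_compat_r; [|lra].
  apply Rlt_le, Rinv_0_lt_compat, pow_lt; lra.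
- rewrite Hw2; apply Rle_lt_trans with (2 := Hn); apply Rmult_le_compat_r; [|lra].
  apply Rlt_le, Rinv_0_lt_compat, pow_lt; lra.
Qed.

(** Two uses of Cousin's lemma: the function is bounded, and if it stayed below its
    supremum everywhere, it would stay below it by a positive amount. *)
Lemma continuous_rectangle_max (f : R -> R -> R) a b c d : a <= b -> c <= d ->
  (forall x y, a <= x <= b -> c <= y <= d -> continuity_2d_pt f x y) ->
  exists x0 y0, (a <= x0 <= b /\ c <= y0 <= d) /\
    forall x y, a <= x <= b -> c <= y <= d -> f x y <= f x0 y0.
Proof.
intros Hab Hcd Hf.
set (E := fun v => exists x y, (a <= x <= b /\ c <= y <= d) /\ v = f x y).
assert (HB : exists K, forall x y, a <= x <= b -> c <= y <= d -> f x y <= K).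
{ apply (cousin_rectangle (fun a b c d => exists K, forall x y,
     a <= x <= b -> c <= y <= d -> f x y <= K)); trivial.
  - intros a' b' c' d' H1 H2 [K1 HK1] [K2 HK2] [K3 HK3] [K4 HK4].
    exists (Rmax (Rmax K1 K2) (Rmax K3 K4)); intros x y Hx Hy.
    generalize (Rmax_l K1 K2) (Rmax_r K1 K2) (Rmax_l K3 K4) (Rmax_r K3 K4)
      (Rmax_l (Rmax K1 K2) (Rmax K3 K4)) (Rmax_r (Rmax K1 K2) (Rmax K3 K4)); intros.
    destruct (Rle_dec x ((a' + b') / 2)), (Rle_dec y ((c' + d') / 2)).
    + specialize (HK1 x y ltac:(lra) ltac:(lra)); lra.
    + specialize (HK3 x y ltac:(lra) ltac:(lra)); lra.
    + specialize (HK2 x y ltac:(lra) ltac:(lra)); lra.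
    + specialize (HK4 x y ltac:(lra) ltac:(lra)); lra.
  - intros x y Hx Hy.
    destruct (Hf x y Hx Hy (mkposreal 1 Rlt_0_1)) as [del Hdel].
    exists del; split; [apply cond_pos|].
    intros a' b' c' d' H1 H2 H3 H4 H5 H6; exists (f x y + 1); intros u v Hu Hv.
    specialize (Hdel u v ltac:(apply Rabs_lt_between; lra) ltac:(apply Rabs_lt_between; lra)).
    simpl in Hdel; apply Rabs_lt_between in Hdel; lra. }
destruct (completeness E) as [M [HM1 HM2]].
{ destruct HB as [K HK]; exists K; intros v [x [y [[? ?] ->]]]; auto. }
{ exists (f a c), a, c; repeat split; lra. }
apply NNPP; intro Hno.
assert (Hlt : forall x y, a <= x <= b -> c <= y <= d -> f x y < M).
{ intros x y Hx Hy.
  destruct (Rle_lt_or_eq_dec (f x y) M) as [|Heq]; trivial.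
  - apply HM1; exists x, y; auto.
  - exfalso; apply Hno; exists x, y; repeat split; try lra.
    intros u v Hu Hv; rewrite Heq; apply HM1; exists u, v; auto. }
assert (Hgap : exists del, 0 < del /\ forall x y, a <= x <= b -> c <= y <= d -> f x y <= M - del).
{ apply (cousin_rectangle (fun a b c d => exists K, 0 < K /\ forall x y,
     a <= x <= b -> c <= y <= d -> f x y <= M - K)); trivial.
  - intros a' b' c' d' H1 H2 [K1 [P1 HK1]] [K2 [P2 HK2]] [K3 [P3 HK3]] [K4 [P4 HK4]].
    exists (Rmin (Rmin K1 K2) (Rmin K3 K4)); split.
    { repeat apply Rmin_glb_lt; trivial. }
    intros x y Hx Hy.
    generalize (Rmin_l K1 K2) (Rmin_r K1 K2) (Rmin_l K3 K4) (Rmin_r K3 K4)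
      (Rmin_l (Rmin K1 K2) (Rmin K3 K4)) (Rmin_r (Rmin K1 K2) (Rmin K3 K4)); intros.
    destruct (Rle_dec x ((a' + b') / 2)), (Rle_dec y ((c' + d') / 2)).
    + specialize (HK1 x y ltac:(lra) ltac:(lra)); lra.
    + specialize (HK3 x y ltac:(lra) ltac:(lra)); lra.
    + specialize (HK2 x y ltac:(lra) ltac:(lra)); lra.
    + specialize (HK4 x y ltac:(lra) ltac:(lra)); lra.
  - intros x y Hx Hy. generalize (Hlt x y Hx Hy); intro Hxy.
    assert (Hp : 0 < (M - f x y) / 2) by lra.
    destruct (Hf x y Hx Hy (mkposreal _ Hp)) as [del Hdel].
    exists del; split; [apply cond_pos|].
    intros a' b' c' d' H1 H2 H3 H4 H5 H6; exists ((M - f x y) / 2); split; [lra|].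
    intros u v Hu Hv.
    specialize (Hdel u v ltac:(apply Rabs_lt_between; lra) ltac:(apply Rabs_lt_between; lra)).
    simpl in Hdel; apply Rabs_lt_between in Hdel; lra. }
destruct Hgap as [del [Hdel Hg]].
assert (M <= M - del); [|lra].
apply HM2; intros v [x [y [[? ?] ->]]]; auto.
Qed.

(** * Goursat's theorem on rectangles *)
Lemma RInt_near_const (f : R -> R) a b k e : a <= b -> ex_RInt f a b ->
  (forall x, a <= x <= b -> Rabs (f x - k) <= e) ->
  Rabs (RInt f a b - k * (b - a)) <= e * (b - a).
Proof.
intros Hab Hf He.
assert (HU : RInt f a b <= (b - a) * (k + e)).
{ replace ((b - a) * (k + e)) with (RInt (fun _ => k + e) a b) by (rewrite RInt_const; reflexivity).
  apply RInt_le; trivial; [apply ex_RInt_const|].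
  intros x Hx; specialize (He x ltac:(lra)); apply Rabs_le_between in He; lra. }
assert (HL : (b - a) * (k - e) <= RInt f a b).
{ replace ((b - a) * (k - e)) with (RInt (fun _ => k - e) a b) by (rewrite RInt_const; reflexivity).
  apply RInt_le; trivial; [apply ex_RInt_const|].
  intros x Hx; specialize (He x ltac:(lra)); apply Rabs_le_between in He; lra. }
apply Rabs_le_between; lra.
Qed.

Lemma continuity_2d_section_x f x y : continuity_2d_pt f x y -> continuous (fun u => f u y) x.
Proof.
intros H; apply continuity_pt_filterlim, continuity_pt_locally; intros eps.
destruct (H eps) as [del Hd]; exists del; intros u Hu.
apply Hd; [exact Hu|]. rewrite Rminus_diag, Rabs_R0; apply cond_pos.
Qed.

Lemma continuity_2d_section_y f x y : continuity_2d_pt f x y -> continuous (fun v => f x v) y.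
Proof.
intros H; apply continuity_pt_filterlim, continuity_pt_locally; intros eps.
destruct (H eps) as [del Hd]; exists del; intros u Hu.
apply Hd; [|exact Hu]. rewrite Rminus_diag, Rabs_R0; apply cond_pos.
Qed.

Definition boundary_integral (P Q : R -> R -> R) (a b c d : R) : R :=
  RInt (fun x => P x c) a b + RInt (fun y => Q b y) c d
  - RInt (fun x => P x d) a b - RInt (fun y => Q a y) c d.

(** P and Q have total differentials at (x, y), and d (P dx + Q dy) = 0 at that
    point. *)
Definition closed_form_at (P Q : R -> R -> R) (x y : R) : Prop :=
  exists px k qy, differentiable_pt_lim P x y px k /\ differentiable_pt_lim Q x y k qy.

Lemma closed_form_continuity P Q x y : closed_form_at P Q x y ->
  continuity_2d_pt P x y /\ continuity_2d_pt Q x y.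
Proof.
intros [px [k [qy [HP HQ]]]]; split; apply differentiable_continuity_pt.
- exists px, k; exact HP.
- exists k, qy; exact HQ.
Qed.

(** The linear parts of P and Q at (x0, y0) contribute nothing, because
    the y-derivative of P cancels the x-derivative of Q; only the
    o(diameter) remainders, integrated over the perimeter, are left. *)
Lemma boundary_integral_local P Q x0 y0 eps : 0 < eps -> closed_form_at P Q x0 y0 ->
  exists delta, 0 < delta /\ forall a b c d, a <= x0 <= b -> c <= y0 <= d ->
    b - a < delta -> d - c < delta ->
    (forall x y, a <= x <= b -> c <= y <= d ->
       continuity_2d_pt P x y /\ continuity_2d_pt Q x y) ->
    Rabs (boundary_integral P Q a b c d) <= eps * ((b - a) + (d - c)) ^ 2.
Proof.
intros Heps [px [k [qy [HP HQ]]]].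
assert (He : 0 < eps / 2) by lra.
destruct (HP (mkposreal _ He)) as [d1 Hd1].
destruct (HQ (mkposreal _ He)) as [d2 Hd2].
exists (Rmin d1 d2); split; [apply Rmin_glb_lt; apply cond_pos|].
intros a b c d Hx0 Hy0 Hw Hh Hcont.
apply Rmin_Rgt_l in Hw; apply Rmin_Rgt_l in Hh.
set (s := (b - a) + (d - c)).
assert (Hmax : forall x y, a <= x <= b -> c <= y <= d ->
          Rmax (Rabs (x - x0)) (Rabs (y - y0)) <= s).
{ intros x y Hx Hy; unfold s; apply Rmax_lub; apply Rabs_le; lra. }
assert (HPe : forall x y, a <= x <= b -> c <= y <= d ->
          Rabs (P x y - P x0 y0 - (px * (x - x0) + k * (y - y0))) <= eps / 2 * s).
{ intros x y Hx Hy. eapply Rle_trans; [apply Hd1; apply Rabs_lt_between; lra|].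
  simpl; apply Rmult_le_compat_l; [lra|]; auto. }
assert (HQe : forall x y, a <= x <= b -> c <= y <= d ->
          Rabs (Q x y - Q x0 y0 - (k * (x - x0) + qy * (y - y0))) <= eps / 2 * s).
{ intros x y Hx Hy. eapply Rle_trans; [apply Hd2; apply Rabs_lt_between; lra|].
  simpl; apply Rmult_le_compat_l; [lra|]; auto. }
assert (HiP : forall y, c <= y <= d -> ex_RInt (fun x => P x y) a b).
{ intros y Hy; apply (ex_RInt_continuous (V := R_CompleteNormedModule)).
  rewrite Rmin_left, Rmax_right by lra; intros x Hx.
  apply continuity_2d_section_x, Hcont; lra. }
assert (HiQ : forall x, a <= x <= b -> ex_RInt (fun y => Q x y) c d).
{ intros x Hx; apply (ex_RInt_continuous (V := R_CompleteNormedModule)).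
  rewrite Rmin_left, Rmax_right by lra; intros y Hy.
  apply continuity_2d_section_y, Hcont; lra. }
assert (H1 : Rabs (RInt (fun x => P x c - P x d) a b - k * (c - d) * (b - a)) <= eps * s * (b - a)).
{ apply RInt_near_const; [lra| |].
  - apply (ex_RInt_minus (V := R_NormedModule)); apply HiP; lra.
  - intros x Hx.
    generalize (HPe x c Hx ltac:(lra)) (HPe x d Hx ltac:(lra)); intros E1 E2.
    apply Rabs_le_between in E1; apply Rabs_le_between in E2; apply Rabs_le; lra. }
assert (H2 : Rabs (RInt (fun y => Q b y - Q a y) c d - k * (b - a) * (d - c)) <= eps * s * (d - c)).
{ apply RInt_near_const; [lra| |].
  - apply (ex_RInt_minus (V := R_NormedModule)); apply HiQ; lra.
  - intros y Hy.
    generalize (HQe a y ltac:(lra) Hy) (HQe b y ltac:(lra) Hy); intros E1 E2.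
    apply Rabs_le_between in E1; apply Rabs_le_between in E2; apply Rabs_le; lra. }
assert (E1 : RInt (fun x => P x c - P x d) a b = RInt (fun x => P x c) a b - RInt (fun x => P x d) a b)
  by (apply (RInt_minus (V := R_CompleteNormedModule)); apply HiP; lra).
assert (E2 : RInt (fun y => Q b y - Q a y) c d = RInt (fun y => Q b y) c d - RInt (fun y => Q a y) c d)
  by (apply (RInt_minus (V := R_CompleteNormedModule)); apply HiQ; lra).
rewrite E1 in H1; rewrite E2 in H2.
apply Rabs_le_between in H1; apply Rabs_le_between in H2.
unfold boundary_integral; fold s.
replace (eps * s ^ 2) with (eps * s * (b - a) + eps * s * (d - c)) by (unfold s; ring).
apply Rabs_le; lra.
Qed.

(** The bound eps * (width + height)^2 is stable under bisection: each of the four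
    quarters has a quarter of it, and boundary integrals add up.  Locally it is
    [boundary_integral_local]. *)
Lemma goursat_rectangle P Q a b c d : a <= b -> c <= d ->
  (forall x y, a <= x <= b -> c <= y <= d -> closed_form_at P Q x y) ->
  boundary_integral P Q a b c d = 0.
Proof.
intros Hab Hcd HPQ.
assert (Hmain : forall eps, 0 < eps ->
   Rabs (boundary_integral P Q a b c d) <= eps * ((b - a) + (d - c)) ^ 2).
{ intros eps Heps.
  assert (HT : (a <= a /\ b <= b) /\ (c <= c /\ d <= d) ->
      Rabs (boundary_integral P Q a b c d) <= eps * ((b - a) + (d - c)) ^ 2);
    [|apply HT; lra].
  apply (cousin_rectangle (fun a' b' c' d' => (a <= a' /\ b' <= b) /\ (c <= c' /\ d' <= d) ->
      Rabs (boundary_integral P Q a' b' c' d') <= eps * ((b' - a') + (d' - c')) ^ 2)); trivial.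
  - intros a' b' c' d' H1 H2 B1 B2 B3 B4 Hin.
    specialize (B1 ltac:(lra)); specialize (B2 ltac:(lra));
    specialize (B3 ltac:(lra)); specialize (B4 ltac:(lra)).
    set (m := (a' + b') / 2) in *; set (n := (c' + d') / 2) in *.
    assert (Hm : a' <= m <= b') by (unfold m; lra).
    assert (Hn : c' <= n <= d') by (unfold n; lra).
    assert (HiP : forall y u v, c' <= y <= d' -> a' <= u -> u <= v -> v <= b' ->
       ex_RInt (fun x => P x y) u v).
    { intros y u v Hy Hu Huv Hv; apply (ex_RInt_continuous (V := R_CompleteNormedModule)).
      rewrite Rmin_left, Rmax_right by lra; intros x Hx.
      apply continuity_2d_section_x, (closed_form_continuity P Q), HPQ; lra. }
    assert (HiQ : forall x u v, a' <= x <= b' -> c' <= u -> u <= v -> v <= d' ->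
       ex_RInt (fun y => Q x y) u v).
    { intros x u v Hx Hu Huv Hv; apply (ex_RInt_continuous (V := R_CompleteNormedModule)).
      rewrite Rmin_left, Rmax_right by lra; intros y Hy.
      apply continuity_2d_section_y, (closed_form_continuity P Q), HPQ; lra. }
    assert (CP : forall y, c' <= y <= d' -> RInt (fun x => P x y) a' b' =
       RInt (fun x => P x y) a' m + RInt (fun x => P x y) m b').
    { intros y Hy; symmetry; apply (RInt_Chasles (V := R_CompleteNormedModule)); apply HiP; lra. }
    assert (CQ : forall x, a' <= x <= b' -> RInt (fun y => Q x y) c' d' =
       RInt (fun y => Q x y) c' n + RInt (fun y => Q x y) n d').
    { intros x Hx; symmetry; apply (RInt_Chasles (V := R_CompleteNormedModule)); apply HiQ; lra. }
    assert (Hsum : boundary_integral P Q a' b' c' d' =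
      boundary_integral P Q a' m c' n + boundary_integral P Q m b' c' n +
      (boundary_integral P Q a' m n d' + boundary_integral P Q m b' n d')).
    { unfold boundary_integral.
      rewrite (CP c'), (CP d'), (CQ a'), (CQ b') by lra. ring. }
    rewrite Hsum.
    eapply Rle_trans; [apply Rabs_triang|].
    eapply Rle_trans; [apply Rplus_le_compat; apply Rabs_triang|].
    replace (eps * (b' - a' + (d' - c')) ^ 2) with
      (eps * (m - a' + (n - c')) ^ 2 + eps * (b' - m + (n - c')) ^ 2 +
       (eps * (m - a' + (d' - n)) ^ 2 + eps * (b' - m + (d' - n)) ^ 2))
      by (unfold m, n; field).
    lra.
  - intros x y Hx Hy.
    destruct (boundary_integral_local P Q x y eps Heps (HPQ x y Hx Hy)) as [del [Hdel Hl]].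
    exists del; split; trivial.
    intros a' b' c' d' H1 H2 H3 H4 H5 H6 _.
    apply Hl; trivial; [lra..|].
    intros u v Hu Hv; apply closed_form_continuity, HPQ; lra. }
apply Rabs_eq_0, Rle_antisym; [|apply Rabs_pos].
apply le_epsilon; intros e He; rewrite Rplus_0_l.
set (K := ((b - a) + (d - c)) ^ 2) in *.
assert (HK : 0 <= K) by (apply pow2_ge_0).
eapply Rle_trans; [apply (Hmain (e / (K + 1))); apply Rdiv_lt_0_compat; lra|].
apply Rmult_le_reg_r with (K + 1); [lra|].
replace (e / (K + 1) * K * (K + 1)) with (e * K) by (field; lra). nra.
Qed.

(** * Complex differentiability *)
Notation C_is_derive := (is_derive (K := C_AbsRing) (V := C_NormedModule)).
Notation C_ex_derive := (ex_derive (K := C_AbsRing) (V := C_NormedModule)).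

Lemma C_is_derive_eps (f : C -> C) (z l : C) :
  C_is_derive f z l <->
  forall eps, 0 < eps -> exists del, 0 < del /\
    forall w, Cmod (w - z) < del ->
      Cmod (f w - f z - (w - z) * l) <= eps * Cmod (w - z).
Proof.
split.
- intros [_ H] eps Heps.
  specialize (H z (fun P HP => HP) (mkposreal eps Heps)).
  destruct H as [del Hdel].
  exists del; split; [apply cond_pos|].
  intros w Hw; exact (Hdel w Hw).
- intros H; split; [apply is_linear_scal_l|].
  intros x Hx eps.
  assert (x = z) as -> by (symmetry; exact (is_filter_lim_locally_unique _ _ Hx)).
  destruct (H eps (cond_pos eps)) as [del [Hdel H']].
  exists (mkposreal del Hdel); intros w Hw; exact (H' w Hw).
Qed.

(** C is a normed space over itself in two ways, as [C_NormedModule] and as the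
    underlying absolute-valued ring; the chain and product rules mix the two. *)
Lemma C_is_derive_AbsRing (f : C -> C) (z l : C) :
  C_is_derive f z l <-> is_derive (K := C_AbsRing) (V := AbsRing_NormedModule C_AbsRing) f z l.
Proof.
split; intros [_ H]; (split; [apply is_linear_scal_l|]); intros x Hx eps; exact (H x Hx eps).
Qed.

Lemma C_is_derive_comp (f g : C -> C) (z df dg : C) :
  C_is_derive f (g z) df -> C_is_derive g z dg ->
  C_is_derive (fun w => f (g w)) z (dg * df)%C.
Proof.
intros Hf Hg; apply C_is_derive_AbsRing in Hg.
exact (is_derive_comp (K := C_AbsRing) (V := C_NormedModule) f g z df dg Hf Hg).
Qed.

Lemma C_ex_derive_comp (f g : C -> C) (z : C) :
  C_ex_derive f (g z) -> C_ex_derive g z -> C_ex_derive (fun w => f (g w)) z.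
Proof.
intros [df Hf] [dg Hg]; exists (dg * df)%C; apply C_is_derive_comp; assumption.
Qed.

Lemma C_ex_derive_mult (f g : C -> C) (z : C) :
  C_ex_derive f z -> C_ex_derive g z -> C_ex_derive (fun w => (f w * g w)%C) z.
Proof.
intros [df Hf] [dg Hg]; exists (df * g z + f z * dg)%C.
apply C_is_derive_AbsRing in Hf; apply C_is_derive_AbsRing in Hg.
apply C_is_derive_AbsRing.
exact (is_derive_mult (K := C_AbsRing) f g z df dg Hf Hg Cmult_comm).
Qed.

Lemma C_ex_derive_const (a z : C) : C_ex_derive (fun _ => a) z.
Proof. exact (ex_derive_const (K := C_AbsRing) (V := C_NormedModule) a z). Qed.

Lemma C_ex_derive_id (z : C) : C_ex_derive (fun w => w) z.
Proof.
exists (RtoC 1). apply C_is_derive_AbsRing. exact (is_derive_id (K := C_AbsRing) z).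
Qed.

Lemma C_ex_derive_plus (f g : C -> C) (z : C) :
  C_ex_derive f z -> C_ex_derive g z -> C_ex_derive (fun w => (f w + g w)%C) z.
Proof. exact (ex_derive_plus (K := C_AbsRing) (V := C_NormedModule) f g z). Qed.

Lemma Cmod_le_Rabs (z : C) : Cmod z <= Rabs (fst z) + Rabs (snd z).
Proof.
destruct z as [x y]; unfold Cmod; simpl.
apply Rsqr_incr_0_var; [|generalize (Rabs_pos x) (Rabs_pos y); lra].
rewrite Rsqr_sqrt by nra. unfold Rsqr.
generalize (Rabs_pos x) (Rabs_pos y).
assert (Hx : x * x = Rabs x * Rabs x) by (rewrite <- Rabs_mult, Rabs_pos_eq; nra).
assert (Hy : y * y = Rabs y * Rabs y) by (rewrite <- Rabs_mult, Rabs_pos_eq; nra).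
intros; rewrite !Rmult_1_r, Hx, Hy; nra.
Qed.

Lemma Rabs_fst_Cmod (z : C) : Rabs (fst z) <= Cmod z.
Proof. eapply Rle_trans; [apply Rmax_l|apply Rmax_Cmod]. Qed.

Lemma Rabs_snd_Cmod (z : C) : Rabs (snd z) <= Cmod z.
Proof. eapply Rle_trans; [apply Rmax_r|apply Rmax_Cmod]. Qed.

(** In this form the lemma says that Im f dx + Re f dy is closed in the sense of
    [closed_form_at]. *)
Lemma cauchy_riemann (f : C -> C) (x y : R) : C_ex_derive f (x, y) ->
  exists p q, differentiable_pt_lim (fun u v => fst (f (u, v))) x y p (- q) /\
              differentiable_pt_lim (fun u v => snd (f (u, v))) x y q p.
Proof.
intros [[p q] H]; exists p, q.
rewrite C_is_derive_eps in H.
assert (Hd : forall eps : posreal, locally_2d (fun u v =>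
   Cmod (f (u, v) - f (x, y) - ((u, v) - (x, y)) * (p, q)) <=
   eps * Rmax (Rabs (u - x)) (Rabs (v - y))) x y).
{ intros eps; destruct (H (eps / 2)) as [del [Hdel Hf]].
  { generalize (cond_pos eps); lra. }
  assert (Hd2 : 0 < del / 2) by lra.
  exists (mkposreal _ Hd2); simpl; intros u v Hu Hv.
  assert (Hm : Cmod ((u, v) - (x, y)) <= Rabs (u - x) + Rabs (v - y))
    by (apply (Cmod_le_Rabs ((u, v) - (x, y)))).
  eapply Rle_trans; [apply Hf; lra|].
  generalize (Rmax_l (Rabs (u - x)) (Rabs (v - y))) (Rmax_r (Rabs (u - x)) (Rabs (v - y))) (cond_pos eps).
  intros; nra. }
split; intros eps; destruct (Hd eps) as [del Hdel]; exists del; intros u v Hu Hv;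
  eapply Rle_trans; [|apply (Hdel u v Hu Hv)| |apply (Hdel u v Hu Hv)].
- eapply Rle_trans; [|apply Rabs_fst_Cmod]; right; f_equal; simpl; ring.
- eapply Rle_trans; [|apply Rabs_snd_Cmod]; right; f_equal; simpl; ring.
Qed.

Lemma C_ex_derive_continuity_2d (f : C -> C) (x y : R) : C_ex_derive f (x, y) ->
  continuity_2d_pt (fun u v => fst (f (u, v))) x y /\
  continuity_2d_pt (fun u v => snd (f (u, v))) x y.
Proof.
intros H; destruct (cauchy_riemann f x y H) as [p [q [H1 H2]]].
split; apply differentiable_continuity_pt; eexists; eexists; eassumption.
Qed.

Lemma Cmod_continuity_2d (f : C -> C) (x y : R) : C_ex_derive f (x, y) ->
  continuity_2d_pt (fun u v => Cmod (f (u, v))) x y.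
Proof.
intros H; destruct (C_ex_derive_continuity_2d f x y H) as [H1 H2].
unfold Cmod; apply continuity_1d_2d_pt_comp.
- apply continuity_pt_filterlim, continuous_sqrt.
- apply continuity_2d_pt_ext with
   (fun u v => fst (f (u, v)) * fst (f (u, v)) + snd (f (u, v)) * snd (f (u, v))).
  + intros u v; ring.
  + apply continuity_2d_pt_plus; apply continuity_2d_pt_mult; assumption.
Qed.

(** * The complex exponential *)
Definition Cexp (z : C) : C := (exp (fst z) * cos (snd z), exp (fst z) * sin (snd z)).

Lemma Cexp_plus z w : Cexp (z + w) = (Cexp z * Cexp w)%C.
Proof.
destruct z as [x y], w as [u v]; unfold Cexp, Cplus, Cmult; simpl.
rewrite exp_plus, cos_plus, sin_plus; f_equal; ring.
Qed.

Lemma Cmod_Cexp z : Cmod (Cexp z) = exp (fst z).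
Proof.
unfold Cmod, Cexp; simpl.
replace (_ + _) with (Rsqr (exp (fst z))).
- apply sqrt_Rsqr, Rlt_le, exp_pos.
- transitivity (Rsqr (exp (fst z)) * (Rsqr (sin (snd z)) + Rsqr (cos (snd z)))).
  + rewrite sin2_cos2; ring.
  + unfold Rsqr; ring.
Qed.

Lemma derivable_at_0_eps (f : R -> R) l : derivable_pt_lim f 0 l ->
  forall eps, 0 < eps -> exists del, 0 < del /\ forall x, Rabs x < del ->
    Rabs (f x - f 0 - l * x) <= eps * Rabs x.
Proof.
intros H eps Heps; destruct (H eps Heps) as [del Hdel].
exists del; split; [apply cond_pos|].
intros x Hx; destruct (Req_dec x 0) as [->|Hx0].
- replace (f 0 - f 0 - l * 0) with 0 by ring; rewrite Rabs_R0; lra.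
- specialize (Hdel x Hx0 Hx); rewrite Rplus_0_l in Hdel.
  replace (f x - f 0 - l * x) with (((f x - f 0) / x - l) * x) by (field; trivial).
  rewrite Rabs_mult; apply Rmult_le_compat_r; [apply Rabs_pos|lra].
Qed.

Lemma C_is_derive_Cexp z : C_is_derive Cexp z (Cexp z).
Proof.
assert (H0 : forall eps, 0 < eps -> exists del, 0 < del /\
    forall w, Cmod w < del -> Cmod (Cexp w - 1 - w) <= eps * Cmod w).
{ intros eps Heps.
  assert (He : 0 < eps / 8) by lra.
  destruct (derivable_at_0_eps exp 1) with (eps := Rmin (eps / 8) 1) as [d1 [D1 H1]].
  { rewrite <- exp_0; apply derivable_pt_lim_exp. } { apply Rmin_glb_lt; lra. }
  destruct (derivable_at_0_eps cos 0) with (eps := eps / 8) as [d2 [D2 H2]]; trivial.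
  { generalize (derivable_pt_lim_cos 0); rewrite sin_0, Ropp_0; trivial. }
  destruct (derivable_at_0_eps sin 1) with (eps := Rmin (eps / 8) 1) as [d3 [D3 H3]].
  { rewrite <- cos_0; apply derivable_pt_lim_sin. } { apply Rmin_glb_lt; lra. }
  exists (Rmin (Rmin d1 d2) (Rmin d3 (Rmin (eps / 16) (1 / 4)))); split.
  { repeat apply Rmin_glb_lt; lra. }
  intros [x y] Hw.
  generalize (Rabs_fst_Cmod (x, y)) (Rabs_snd_Cmod (x, y)); simpl; intros Hx Hy.
  repeat (apply Rmin_Rgt_l in Hw; destruct Hw as [? Hw]).
  repeat match goal with H : Rmin _ _ > _ |- _ => apply Rmin_Rgt_l in H; destruct H end.
  set (r := Cmod (x, y)) in *.
  specialize (H1 x ltac:(lra)); specialize (H2 y ltac:(lra)); specialize (H3 y ltac:(lra)).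
  rewrite exp_0 in H1; rewrite cos_0 in H2; rewrite sin_0 in H3.
  generalize (Rmin_l (eps / 8) 1) (Rmin_r (eps / 8) 1); intros M1 M2.
  set (m := Rmin (eps / 8) 1) in *.
  assert (Hm : 0 < m) by (unfold m; apply Rmin_glb_lt; lra).
  generalize (Rabs_pos x) (Rabs_pos y); intros Px Py.
  assert (E1 : Rabs (exp x - 1) <= 2 * r).
  { replace (exp x - 1) with ((exp x - 1 - 1 * x) + x) by ring.
    eapply Rle_trans; [apply Rabs_triang|]. nra. }
  assert (S1 : Rabs (sin y) <= 2 * r).
  { replace (sin y) with ((sin y - 0 - 1 * y) + y) by ring.
    eapply Rle_trans; [apply Rabs_triang|]. nra. }
  assert (E2 : Rabs (exp x) <= 2).
  { replace (exp x) with ((exp x - 1) + 1) by ring.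
    eapply Rle_trans; [apply Rabs_triang|]. rewrite Rabs_R1. lra. }
  eapply Rle_trans; [apply Cmod_le_Rabs|]; simpl.
  assert (A1 : Rabs (exp x * cos y + - (1) + - x) <= eps / 2 * r).
  { replace (exp x * cos y + - (1) + - x) with
      ((exp x - 1 - 1 * x) + exp x * (cos y - 1 - 0 * y)) by ring.
    eapply Rle_trans; [apply Rabs_triang|]. rewrite Rabs_mult.
    assert (Rabs (exp x) * Rabs (cos y - 1 - 0 * y) <= 2 * (eps / 8 * Rabs y)).
    { apply Rmult_le_compat; trivial; apply Rabs_pos. }
    nra. }
  assert (A2 : Rabs (exp x * sin y + - 0 + - y) <= eps / 2 * r).
  { replace (exp x * sin y + - 0 + - y) with
      ((sin y - 0 - 1 * y) + (exp x - 1) * sin y) by ring.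
    eapply Rle_trans; [apply Rabs_triang|]. rewrite Rabs_mult.
    assert (Rabs (exp x - 1) * Rabs (sin y) <= (2 * r) * (2 * r)).
    { apply Rmult_le_compat; trivial; apply Rabs_pos. }
    nra. }
  lra. }
apply C_is_derive_eps; intros eps Heps.
assert (Hp : 0 < exp (fst z)) by apply exp_pos.
destruct (H0 (eps / exp (fst z))) as [del [Hdel H]]; [apply Rdiv_lt_0_compat; lra|].
exists del; split; trivial.
intros w Hw; specialize (H (w - z)%C Hw).
replace (Cexp w) with (Cexp z * Cexp (w - z))%C
  by (rewrite <- Cexp_plus; f_equal; ring).
replace (Cexp z * Cexp (w - z) - Cexp z - (w - z) * Cexp z)%C
  with (Cexp z * (Cexp (w - z) - 1 - (w - z)))%C by ring.
rewrite Cmod_mult, Cmod_Cexp.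
replace (eps * Cmod (w - z)) with (exp (fst z) * (eps / exp (fst z) * Cmod (w - z)))
  by (field; lra).
apply Rmult_le_compat_l; lra.
Qed.

Lemma C_ex_derive_Cexp z : C_ex_derive Cexp z.
Proof. exists (Cexp z); apply C_is_derive_Cexp. Qed.

Lemma exists_polar (t : C) : t <> RtoC 0 -> exists theta, - PI <= theta <= PI /\
  t = Cexp (ln (Cmod t), theta).
Proof.
intros Ht.
assert (Hr : 0 < Cmod t) by (apply Cmod_gt_0; trivial).
set (r := Cmod t) in *.
destruct t as [x y].
assert (Hr2 : r * r = x * x + y * y).
{ unfold r, Cmod; simpl; rewrite sqrt_sqrt by nra; ring. }
assert (Hx : -1 <= x / r <= 1).
{ generalize (Rabs_fst_Cmod (x, y)); simpl; fold r; intro H; apply Rabs_le_between in H.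
  split; apply Rmult_le_reg_r with r; trivial; field_simplify; lra. }
assert (Hs : sin (acos (x / r)) = Rabs y / r).
{ rewrite sin_acos by trivial.
  rewrite <- (sqrt_Rsqr (Rabs y / r)).
  - f_equal; unfold Rsqr.
    replace (Rabs y / r * (Rabs y / r)) with ((Rabs y * Rabs y) / (r * r)) by (field; lra).
    rewrite <- Rabs_mult, Rabs_pos_eq by nra.
    replace (y * y) with (r * r - x * x) by lra. field; lra.
  - apply Rmult_le_pos; [apply Rabs_pos|apply Rlt_le, Rinv_0_lt_compat, Hr]. }
generalize (acos_bound (x / r)); intros [B1 B2].
generalize PI_RGT_0; intro HPI.
destruct (Rle_dec 0 y) as [Hy|Hy].
- exists (acos (x / r)); split; [lra|].
  unfold Cexp; simpl; rewrite exp_ln, cos_acos, Hs, Rabs_pos_eq by lra.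
  f_equal; field; lra.
- exists (- acos (x / r)); split; [lra|].
  unfold Cexp; simpl; rewrite sin_neg, cos_neg, exp_ln, cos_acos, Hs, Rabs_left by lra.
  f_equal; field; lra.
Qed.

(** * The mean value property *)
Lemma C_ex_derive_eps_continuous (f : C -> C) (z : C) : C_ex_derive f z ->
  forall eps, 0 < eps -> exists del, 0 < del /\ forall w, Cmod (w - z) < del -> Cmod (f w - f z) < eps.
Proof.
intros [l H] eps Heps; rewrite C_is_derive_eps in H.
destruct (H 1 Rlt_0_1) as [d1 [D1 H1]].
assert (Hl : 0 <= Cmod l) by apply Cmod_ge_0.
exists (Rmin d1 (eps / (2 * (Cmod l + 1)))); split.
{ apply Rmin_glb_lt; trivial; apply Rdiv_lt_0_compat; lra. }
intros w Hw; apply Rmin_Rgt_l in Hw; destruct Hw as [W1 W2].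
specialize (H1 w W1).
replace (f w - f z)%C with ((f w - f z - (w - z) * l) + (w - z) * l)%C by ring.
eapply Rle_lt_trans; [apply Cmod_triangle|]; rewrite Cmod_mult.
assert (Cmod (w - z) * (2 * (Cmod l + 1)) < eps).
{ apply Rmult_lt_reg_r with (/ (2 * (Cmod l + 1))); [apply Rinv_0_lt_compat; lra|].
  rewrite Rmult_assoc, Rinv_r by lra. lra. }
generalize (Cmod_ge_0 (w - z)); nra.
Qed.

Lemma Cmod_circle r theta : 0 < r -> Cmod (Cexp (ln r, theta)) = r.
Proof. intro Hr; rewrite Cmod_Cexp; simpl; apply exp_ln, Hr. Qed.

Lemma Cplus_minus_l (c z : C) : (c + z - c)%C = z.
Proof. ring. Qed.

Lemma holomorphic_circle (f : C -> C) (c : C) rho theta : C_ex_derive f (c + Cexp (rho, theta))%C ->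
  C_ex_derive (fun w => f (c + Cexp w)%C) (rho, theta).
Proof.
intros H; apply (C_ex_derive_comp f (fun w => c + Cexp w)%C); trivial.
apply C_ex_derive_plus; [apply C_ex_derive_const|apply C_ex_derive_Cexp].
Qed.

Lemma circle_continuous (f : C -> C) (c : C) r : 0 < r ->
  (forall z, Cmod (z - c) <= r -> C_ex_derive f z) ->
  forall theta, continuous (fun y => fst (f (c + Cexp (ln r, y))%C)) theta.
Proof.
intros Hr Hf theta.
apply (continuity_2d_section_y (fun x y => fst (f (c + Cexp (x, y))%C))).
apply (C_ex_derive_continuity_2d (fun w => f (c + Cexp w)%C)).
apply holomorphic_circle, Hf.
rewrite Cplus_minus_l.
rewrite Cmod_circle; lra.
Qed.

(** The function w |-> f (c + e^w) is holomorphic on the rectangle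
    [ln r0, ln r] x [0, 2 pi], which it turns into an annulus around c.  Goursat's theorem
    applies there; by periodicity the two horizontal sides cancel, and the
    vertical sides are the two circle integrals. *)
Lemma circle_integral_constant (f : C -> C) (c : C) r0 r : 0 < r0 <= r ->
  (forall z, Cmod (z - c) <= r -> C_ex_derive f z) ->
  RInt (fun y => fst (f (c + Cexp (ln r, y))%C)) 0 (2 * PI) =
  RInt (fun y => fst (f (c + Cexp (ln r0, y))%C)) 0 (2 * PI).
Proof.
intros Hr Hf; generalize PI_RGT_0; intro HPI.
assert (Hln : ln r0 <= ln r) by (apply ln_le; lra).
assert (HG := goursat_rectangle (fun x y => snd (f (c + Cexp (x, y))%C))
                (fun x y => fst (f (c + Cexp (x, y))%C)) (ln r0) (ln r) 0 (2 * PI)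
                Hln ltac:(lra)).
unfold boundary_integral in HG.
assert (Hper : forall x, Cexp (x, 2 * PI) = Cexp (x, 0)).
{ intro x; unfold Cexp; simpl; rewrite cos_2PI, sin_2PI, cos_0, sin_0; reflexivity. }
rewrite (RInt_ext (fun x => snd (f (c + Cexp (x, (2 * PI)%R))%C)) (fun x => snd (f (c + Cexp (x, 0))%C))) in HG
  by (intros x _; rewrite Hper; reflexivity).
enough (forall x y, ln r0 <= x <= ln r -> 0 <= y <= 2 * PI -> closed_form_at
  (fun x y => snd (f (c + Cexp (x, y))%C)) (fun x y => fst (f (c + Cexp (x, y))%C)) x y) as H.
{ specialize (HG H); lra. }
intros x y Hx _.
destruct (cauchy_riemann (fun w => f (c + Cexp w)%C) x y) as [p [q [H1 H2]]].
- apply holomorphic_circle, Hf.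
  rewrite Cplus_minus_l.
  rewrite Cmod_Cexp; simpl; rewrite <- (exp_ln r) by lra.
  destruct (Rle_lt_or_eq_dec x (ln r)) as [H|H]; [lra| |].
  + apply Rlt_le, exp_increasing, H.
  + rewrite H; lra.
- exists q, p, (- q); split; assumption.
Qed.

Lemma mean_value (f : C -> C) (c : C) r : 0 < r ->
  (forall z, Cmod (z - c) <= r -> C_ex_derive f z) ->
  RInt (fun y => fst (f (c + Cexp (ln r, y))%C)) 0 (2 * PI) = 2 * PI * fst (f c).
Proof.
intros Hr Hf; generalize PI_RGT_0; intro HPI.
apply Rminus_diag_uniq, Rabs_eq_0, Rle_antisym; [|apply Rabs_pos].
apply le_epsilon; intros e He; rewrite Rplus_0_l.
destruct (C_ex_derive_eps_continuous f c) with (eps := e / (2 * PI)) as [del [Hdel Hc]].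
{ apply Hf; replace (c - c)%C with (RtoC 0) by ring; rewrite Cmod_0; lra. }
{ apply Rdiv_lt_0_compat; lra. }
set (r0 := Rmin r (del / 2)).
assert (Hr0 : 0 < r0 <= r /\ r0 < del).
{ unfold r0; generalize (Rmin_l r (del / 2)) (Rmin_r r (del / 2)).
  assert (0 < Rmin r (del / 2)) by (apply Rmin_glb_lt; lra). lra. }
rewrite (circle_integral_constant f c r0 r) by (trivial; lra).
replace e with (e / (2 * PI) * (2 * PI - 0)) by (field; lra).
replace (2 * PI * fst (f c)) with (fst (f c) * (2 * PI - 0)) by ring.
apply RInt_near_const; [lra| |].
- apply (ex_RInt_continuous (V := R_CompleteNormedModule)); intros y _.
  apply circle_continuous; [lra|]. intros z Hz; apply Hf; lra.
- intros y _; apply Rlt_le.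
  eapply Rle_lt_trans; [|apply (Hc (c + Cexp (ln r0, y))%C)].
  + apply (Rabs_fst_Cmod (f (c + Cexp (ln r0, y)) - f c)%C).
  + rewrite Cplus_minus_l.
    rewrite Cmod_circle; lra.
Qed.

Lemma RInt_nonneg_zero_left (f : R -> R) a b : a < b ->
  (forall x, a <= x <= b -> continuous f x) ->
  (forall x, a <= x <= b -> 0 <= f x) -> RInt f a b <= 0 -> f a <= 0.
Proof.
intros Hab Hc Hpos Hint; apply Rnot_lt_le; intro Ha.
assert (Hca := Hc a ltac:(lra)).
apply continuity_pt_filterlim in Hca; rewrite continuity_pt_locally in Hca.
assert (He : 0 < f a / 2) by lra.
destruct (Hca (mkposreal _ He)) as [del Hdel].
set (m := Rmin b (a + del / 2)).
assert (Hm : a < m <= b /\ m < a + del).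
{ unfold m; generalize (Rmin_l b (a + del / 2)) (Rmin_r b (a + del / 2)) (cond_pos del).
  intros; assert (a < Rmin b (a + del / 2)) by (apply Rmin_glb_lt; lra). lra. }
assert (Hi : forall u v, a <= u -> u <= v -> v <= b -> ex_RInt f u v).
{ intros u v Hu Huv Hv; apply (ex_RInt_continuous (V := R_CompleteNormedModule)).
  rewrite Rmin_left, Rmax_right by lra; intros x Hx; apply Hc; lra. }
assert (H1 : (m - a) * (f a / 2) <= RInt f a m).
{ replace ((m - a) * (f a / 2)) with (RInt (fun _ => f a / 2) a m)
    by (rewrite RInt_const; reflexivity).
  apply RInt_le; [lra|apply ex_RInt_const|apply Hi; lra|].
  intros x Hx; specialize (Hdel x).
  assert (Rabs (f x - f a) < f a / 2) as Hx'.
  { apply Hdel; apply Rabs_lt_between; unfold minus, plus, opp; simpl; lra. }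
  apply Rabs_lt_between in Hx'; lra. }
assert (H2 : 0 <= RInt f m b).
{ apply RInt_ge_0; [lra|apply Hi; lra|]. intros x Hx; apply Hpos; lra. }
assert (H3 : RInt f a b = RInt f a m + RInt f m b).
{ symmetry; apply (RInt_Chasles (V := R_CompleteNormedModule)); apply Hi; lra. }
assert (0 < (m - a) * (f a / 2)) by (apply Rmult_lt_0_compat; lra).
lra.
Qed.

(** The value f (c) is the mean of f over the circle, so if |f (c)| is at least the
    bound M of |f| on that circle, then |f| = M at each point of the circle, in
    particular at the rightmost one.  Multiplying f by the conjugate of f (c) reduces the
    claim to real parts. *)
Lemma maximum_on_circle (f : C -> C) (c : C) r M : 0 < r ->
  (forall z, Cmod (z - c) <= r -> C_ex_derive f z) ->
  (forall z, Cmod (z - c) = r -> Cmod (f z) <= M) ->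
  M <= Cmod (f c) -> M <= Cmod (f (c + r)%C).
Proof.
intros Hr Hf HM Hc; generalize PI_RGT_0; intro HPI.
set (k := Cconj (f c)).
assert (Hk : Cmod k = Cmod (f c)) by apply Cmod_conj.
set (g := fun z => (k * f z)%C).
assert (Hg : forall z, Cmod (z - c) <= r -> C_ex_derive g z).
{ intros z Hz; apply C_ex_derive_mult; [apply C_ex_derive_const|auto]. }
assert (Hgc : fst (g c) = Cmod (f c) ^ 2).
{ unfold g; rewrite Cmult_comm. generalize (Cmod2_conj (f c)); fold k; intros <-; reflexivity. }
assert (Hcircle : forall y, Cmod (c + Cexp (ln r, y) - c) = r).
{ intro y; rewrite Cplus_minus_l.
  apply Cmod_circle, Hr. }
assert (Hle : forall y, fst (g (c + Cexp (ln r, y))%C) <=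
                 Cmod (f c) * Cmod (f (c + Cexp (ln r, y))%C)).
{ intro y; eapply Rle_trans; [apply Rle_abs|]; eapply Rle_trans; [apply Rabs_fst_Cmod|].
  unfold g; rewrite Cmod_mult, Hk; lra. }
assert (H0 : Cmod (f c) ^ 2 - fst (g (c + Cexp (ln r, 0))%C) <= 0).
{ apply (RInt_nonneg_zero_left (fun y => Cmod (f c) ^ 2 - fst (g (c + Cexp (ln r, y))%C)) 0 (2 * PI)).
  - lra.
  - intros y _; apply (continuous_minus (V := R_NormedModule)); [apply continuous_const|].
    apply circle_continuous; trivial.
  - intros y _; generalize (Hle y) (HM _ (Hcircle y)) (Cmod_ge_0 (f c)); nra.
  - right.
    transitivity (RInt (fun _ => Cmod (f c) ^ 2) 0 (2 * PI) -
                  RInt (fun y => fst (g (c + Cexp (ln r, y))%C)) 0 (2 * PI)).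
    + apply (RInt_minus (V := R_CompleteNormedModule)); [apply ex_RInt_const|].
      apply (ex_RInt_continuous (V := R_CompleteNormedModule)); intros y _.
      apply circle_continuous; trivial.
    + rewrite RInt_const, mean_value, Hgc by trivial.
      unfold scal; simpl; unfold mult; simpl; ring. }
assert (Hr1 : Cexp (ln r, 0) = RtoC r).
{ unfold Cexp; simpl; rewrite cos_0, sin_0, exp_ln by trivial; unfold RtoC; f_equal; ring. }
specialize (Hle 0); rewrite Hr1 in *.
destruct (Req_dec (Cmod (f c)) 0) as [Hz|Hz].
- generalize (Cmod_ge_0 (f (c + r)%C)); lra.
- generalize (Cmod_ge_0 (f c)); intro Hp.
  apply Rle_trans with (1 := Hc), Rmult_le_reg_l with (Cmod (f c)); lra.
Qed.

(** * Growth at a puncture *)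
(** Put Psi_sigma (z) = h (e^z) e^(- sigma z), holomorphic on Re z < 0, with
    |Psi_sigma (z)| = |h (t)| |t|^(- sigma) for t = e^z.  For sigma = s - eps it
    tends to 0 as Re z -> -oo and its modulus is 2 pi i-periodic, so its modulus
    reaches its maximum on the half plane Re z <= -1.  The disk around a maximum
    point that touches the line Re z = -1 carries the maximum to that line
    ([maximum_on_circle]).  On the line, |Psi_sigma| is bounded independently
    of eps, and eps can tend to 0. *)
Lemma growth_at_puncture (h : C -> C) (s : R) :
  holomorphic_on pdisk h ->
  (forall eps, 0 < eps -> exists del, 0 < del /\ forall t, 0 < Cmod t < del ->
     Cmod (h t) <= exp ((s - eps) * ln (Cmod t))) ->
  exists K, 0 < K /\ forall t, 0 < Cmod t <= exp (-1) ->
     Cmod (h t) <= K * exp (s * ln (Cmod t)).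
Proof.
intros Hh Hgrow.
(* The exponent s is real, so e^(- s z) takes the place of the multivalued t^(- s). *)
set (Psi := fun sigma z => (h (Cexp z) * Cexp (RtoC (- sigma) * z))%C).
assert (Hexp1 : exp (-1) < 1) by (rewrite <- exp_0; apply exp_increasing; lra).
assert (HPsi : forall sigma z, fst z <= -1 -> C_ex_derive (Psi sigma) z).
{ intros sigma z Hz; apply C_ex_derive_mult.
  - apply C_ex_derive_comp; [|apply C_ex_derive_Cexp].
    apply Hh; unfold pdisk; rewrite Cmod_Cexp; split; [apply exp_pos|].
    rewrite <- exp_0; apply exp_increasing; lra.
  - apply (C_ex_derive_comp Cexp (fun z => RtoC (- sigma) * z)%C); [apply C_ex_derive_Cexp|].
    apply C_ex_derive_mult; [apply C_ex_derive_const|apply C_ex_derive_id]. }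
assert (HPsimod : forall sigma z, Cmod (Psi sigma z) = Cmod (h (Cexp z)) * exp (- sigma * fst z)).
{ intros sigma z; unfold Psi; rewrite Cmod_mult, Cmod_Cexp; do 2 f_equal; simpl; ring. }
(* K bounds |h| |t|^(- s) on the circle |t| = 1/e. *)
generalize PI_RGT_0; intro HPI.
destruct (continuous_rectangle_max (fun x y => Cmod (Psi s (x, y))) (-1) (-1) (- PI) PI)
  as [u0 [v0 [_ HK0]]]; [lra|lra| |].
{ intros x y Hx _; apply Cmod_continuity_2d, HPsi; simpl; lra. }
set (K := Cmod (Psi s (u0, v0)) + 1) in *.
assert (HK : 0 < K) by (unfold K; generalize (Cmod_ge_0 (Psi s (u0, v0))); lra).
exists K; split; trivial.
assert (Hpolar : forall z, exists v, - PI <= v <= PI /\ Cexp z = Cexp (fst z, v)).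
{ intro z; destruct (exists_polar (Cexp z)) as [v [Hv Hz]].
  - apply Cmod_gt_0; rewrite Cmod_Cexp; apply exp_pos.
  - exists v; rewrite Cmod_Cexp, ln_exp in Hz; auto. }
assert (Hmain : forall eps, 0 < eps -> forall t, 0 < Cmod t <= exp (-1) ->
   Cmod (h t) * exp (- (s - eps) * ln (Cmod t)) <= K).
{ intros eps Heps t Ht.
  assert (Hln : ln (Cmod t) <= -1) by (rewrite <- (ln_exp (-1)); apply ln_le; lra).
  destruct (Hgrow (eps / 2)) as [del [Hdel Hg]]; [lra|].
  set (q := fun z => Cmod (Psi (s - eps) z)).
  assert (Hq : forall z, q z = Cmod (h (Cexp z)) * exp (- (s - eps) * fst z))
    by (intro; apply HPsimod).
  destruct (exists_polar t) as [th [Hth Et]]; [apply Cmod_gt_0; lra|].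
  apply Rnot_lt_le; intro Hlt.
  assert (Hq1 : K < q (ln (Cmod t), th)) by (rewrite Hq, <- Et; exact Hlt).
  set (x0 := Rmin (Rmin (ln (Cmod t)) (ln del - 1)) (2 / eps * ln K)).
  assert (Hx0 : x0 <= ln (Cmod t) /\ x0 < ln del /\ eps / 2 * x0 <= ln K).
  { unfold x0. set (u := Rmin _ _). 
    generalize (Rmin_l (Rmin (ln (Cmod t)) (ln del - 1)) (2 / eps * ln K))
     (Rmin_r (Rmin (ln (Cmod t)) (ln del - 1)) (2 / eps * ln K))
     (Rmin_l (ln (Cmod t)) (ln del - 1)) (Rmin_r (ln (Cmod t)) (ln del - 1)); fold u; intros.
    repeat split; try lra.
    replace (ln K) with (eps / 2 * (2 / eps * ln K)) by (field; lra).
    apply Rmult_le_compat_l; lra. }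
  assert (Hfar : forall z, fst z <= x0 -> q z <= K).
  { intros z Hz; rewrite Hq.
    assert (Hz1 : 0 < Cmod (Cexp z) < del).
    { rewrite Cmod_Cexp; split; [apply exp_pos|].
      rewrite <- (exp_ln del) by trivial; apply exp_increasing; lra. }
    specialize (Hg _ Hz1); rewrite Cmod_Cexp, ln_exp in Hg.
    eapply Rle_trans; [apply Rmult_le_compat_r; [apply Rlt_le, exp_pos|exact Hg]|].
    rewrite <- exp_plus, <- (exp_ln K) by trivial.
    replace ((s - eps / 2) * fst z + - (s - eps) * fst z) with (eps / 2 * fst z) by field.
    assert (eps / 2 * fst z <= ln K) as [H|H] by nra.
    - apply Rlt_le, exp_increasing, H.
    - rewrite H; lra. }
  destruct (continuous_rectangle_max (fun x y => q (x, y)) x0 (-1) (- PI) PI)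
    as [xm [ym [[Hxm Hym] Hmax]]]; [lra|lra| |].
  { intros x y Hx _; apply Cmod_continuity_2d, HPsi; simpl; lra. }
  (* The maximum over this rectangle is one over the half plane: further left q is
     at most K, and q is periodic in the vertical direction. *)
  assert (HqM : K < q (xm, ym)).
  { eapply Rlt_le_trans; [exact Hq1|]. apply Hmax; lra. }
  assert (Hmax' : forall z, fst z <= -1 -> q z <= q (xm, ym)).
  { intros z Hz; destruct (Rle_dec x0 (fst z)) as [H|H].
    - destruct (Hpolar z) as [v [Hv Ez]].
      replace (q z) with (q (fst z, v)) by (rewrite !Hq, Ez; reflexivity).
      apply Hmax; lra.
    - apply Rlt_le, Rle_lt_trans with (2 := HqM), Hfar; lra. }
  (* On Re z = -1 the factor e^(eps Re z) is at most 1, so K also bounds q there. *)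
  assert (HB : forall v, q (-1, v) <= K).
  { intro v; destruct (Hpolar (-1, v)) as [w [Hw Ew]]; simpl in Ew.
    rewrite Hq, Ew; simpl.
    generalize (HK0 (-1) w ltac:(lra) Hw); rewrite HPsimod; simpl.
    fold K; intro HK1.
    apply Rle_trans with (Cmod (h (Cexp (-1, w))) * exp (- s * -1)); [|unfold K; lra].
    apply Rmult_le_compat_l; [apply Cmod_ge_0|].
    apply Rlt_le, exp_increasing; lra. }
  assert (Hxm1 : xm < -1).
  { destruct (Rle_lt_or_eq_dec xm (-1)) as [H|H]; [lra|trivial|].
    subst xm; generalize (HB ym); lra. }
  set (r := -1 - xm).
  assert (HC : q (xm, ym) <= q ((xm, ym) + RtoC r)%C).
  { apply maximum_on_circle; [unfold r; lra| | |unfold q; lra].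
    - intros z Hz; apply HPsi.
      generalize (Rabs_fst_Cmod (z - (xm, ym))%C); simpl; intro H.
      assert (H' := Rle_trans _ _ _ H Hz); apply Rabs_le_between in H'; unfold r in H'; lra.
    - intros z Hz; apply Hmax'.
      generalize (Rabs_fst_Cmod (z - (xm, ym))%C); simpl; intro H.
      rewrite Hz in H; apply Rabs_le_between in H; unfold r in H; lra. }
  replace ((xm, ym) + RtoC r)%C with ((-1, ym) : C) in HC.
  - generalize (HB ym); lra.
  - unfold RtoC, Cplus, r; simpl; f_equal; ring. }
intros t Ht.
apply le_epsilon; intros e He.
set (L := - ln (Cmod t)).
set (E := exp (s * ln (Cmod t))).
assert (HE : 0 < E) by apply exp_pos.
assert (Hln : ln (Cmod t) <= -1) by (rewrite <- (ln_exp (-1)); apply ln_le; lra).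
(* eta is chosen so that K E e^eta = K E + e; then eps = eta / L in Hmain. *)
set (eta := ln (1 + e / (K * E))).
assert (Hke : 0 < e / (K * E)) by (apply Rdiv_lt_0_compat; trivial; apply Rmult_lt_0_compat; trivial).
assert (Heta : 0 < eta) by (unfold eta; rewrite <- ln_1; apply ln_increasing; lra).
assert (HL : 0 < eta / L) by (apply Rdiv_lt_0_compat; unfold L; lra).
specialize (Hmain (eta / L) HL t Ht).
apply Rmult_le_reg_r with (exp (- (s - eta / L) * ln (Cmod t))); [apply exp_pos|].
eapply Rle_trans; [exact Hmain|].
right.
replace (- (s - eta / L) * ln (Cmod t)) with (- (s * ln (Cmod t)) + - eta)
  by (unfold L; field; lra).
rewrite exp_plus, !exp_Ropp; unfold eta; rewrite exp_ln by lra; fold E.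
field; repeat split; try lra.
assert (0 < K * E) by (apply Rmult_lt_0_compat; trivial). lra.
Qed.

(** * A Liouville rotation *)
(** The angle is the sum of 1 / q_k with q_k = [liouville_den] k and
    q_(k+1) = q_k m_k.  The factor m_k is at least 8 pi exp (k 2^(q_k)), so that q_k
    times the angle is within exp (- k 2^(q_k)) / (4 pi) of an integer. *)
Definition liouville_factor (k N : nat) : nat :=
  (2 * k + 2 + Z.to_nat (up (8 * PI * exp (INR k * 2 ^ N))))%nat.

Fixpoint liouville_den (k : nat) : nat :=
  match k with
  | O => 1%nat
  | S k => (liouville_den k * liouville_factor k (liouville_den k))%nat
  end.

Fixpoint liouville_num (k : nat) : nat :=
  match k with
  | O => 0%nat
  | S k => (liouville_num k * liouville_factor k (liouville_den k) + 1)%nat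
  end.

Lemma liouville_factor_bounds k N :
  2 <= INR (liouville_factor k N) /\ 2 * INR k < INR (liouville_factor k N) /\
  8 * PI * exp (INR k * 2 ^ N) <= INR (liouville_factor k N).
Proof.
unfold liouville_factor; rewrite !plus_INR, mult_INR; simpl (INR 2).
set (x := 8 * PI * exp (INR k * 2 ^ N)).
assert (Hx : 0 < x).
{ unfold x; generalize PI_RGT_0 (exp_pos (INR k * 2 ^ N)); intros; nra. }
destruct (archimed x) as [H1 _].
assert (H0 : (0 <= up x)%Z) by (apply le_IZR; simpl; lra).
assert (HZ : INR (Z.to_nat (up x)) = IZR (up x)) by (rewrite INR_IZR_INZ, Z2Nat.id; trivial).
rewrite HZ; generalize (pos_INR k); simpl; repeat split; lra.
Qed.

Lemma liouville_den_pos k : (1 <= liouville_den k)%nat.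
Proof.
induction k; simpl; [lia|].
unfold liouville_factor; nia.
Qed.

(** The partial sums p_k / q_k differ from their limit by a positive amount,
    at most 2 / q_(k+1), since q_(k+1) >= 2 q_k. *)
Lemma exists_liouville_angle : exists alpha, forall k, exists p : nat, exists delta,
  INR (liouville_den k) * alpha = INR p + delta /\
  0 < delta <= 2 / INR (liouville_factor k (liouville_den k)).
Proof.
set (q := liouville_den). set (m := fun k => liouville_factor k (q k)).
assert (Hm : forall k, 2 <= INR (m k)) by (intro k; apply liouville_factor_bounds).
assert (Hq : forall k, 1 <= INR (q k)) by (intro k; apply (le_INR 1), liouville_den_pos).
set (a := fun k => INR (liouville_num k) / INR (q k)).
assert (HqS : forall k, INR (q (S k)) = INR (q k) * INR (m k)) by (intro k; apply mult_INR).
assert (HaS : forall k, a (S k) = a k + 1 / INR (q (S k))).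
{ intro k; unfold a; rewrite HqS; simpl liouville_num.
  rewrite plus_INR, mult_INR; fold q; fold (m k); simpl (INR 1).
  generalize (Hm k) (Hq k); intros; field; split; lra. }
assert (Hinv : forall k, 0 < 1 / INR (q k)).
{ intro k; generalize (Hq k); intro; apply Rdiv_lt_0_compat; lra. }
assert (Hinv2 : forall k, 2 / INR (q (S k)) <= 1 / INR (q k)).
{ intro k; rewrite HqS; generalize (Hm k) (Hq k); intros.
  apply Rmult_le_reg_r with (INR (q k) * INR (m k)); [nra|].
  field_simplify; lra. }
destruct (nested_halves a (fun k => a k + 2 / INR (q (S k)))) as [alpha Ha].
- intro k; generalize (Hinv (S k)); lra.
- intro k; rewrite HaS; generalize (Hinv (S k)); lra.
- intro k; rewrite HaS; generalize (Hinv2 (S k)); lra.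
- exists alpha; intro k; exists (liouville_num k), (INR (q k) * (alpha - a k)).
  fold q; fold (m k); split.
  + unfold a; generalize (Hq k); intro; field; lra.
  + generalize (Ha k) (Ha (S k)) (Hinv (S k)) (HaS k) (Hq k) (Hm k); intros.
    split; [apply Rmult_lt_0_compat; lra|].
    replace (2 / INR (m k)) with (INR (q k) * (2 / INR (q (S k)))).
    * apply Rmult_le_compat_l; lra.
    * rewrite HqS; field; lra.
Qed.

(** A rotation whose powers come super-exponentially close to 1 infinitely often,
    with the rate imposed by the degree 2 of the family, but never return to 1. *)
Definition liouville_multiplier (lam : C) : Prop :=
  Cmod lam = 1 /\
  (forall n, (1 <= n)%nat -> (lam ^ n)%C <> RtoC 1) /\
  (forall K, exists n, (1 <= n)%nat /\ Cmod (lam ^ n - 1) <= exp (- K * 2 ^ n)).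

Lemma Cexp_rotation_pow x n : (Cexp (0, x) ^ n)%C = Cexp (0, INR n * x).
Proof.
induction n.
- unfold Cexp; simpl; rewrite Rmult_0_l, exp_0, cos_0, sin_0.
  unfold RtoC; f_equal; ring.
- rewrite Cpow_S, IHn, <- Cexp_plus; f_equal; rewrite S_INR; unfold Cplus; simpl; f_equal; ring.
Qed.

Lemma Cexp_rotation_turns (p : nat) x : Cexp (0, 2 * PI * (INR p + x)) = Cexp (0, 2 * PI * x).
Proof.
unfold Cexp; simpl.
replace (2 * PI * (INR p + x)) with (2 * PI * x + 2 * INR p * PI) by ring.
rewrite cos_period, sin_period; reflexivity.
Qed.

Lemma Cexp_rotation_near_1 x : 0 < x <= 1 -> Cmod (Cexp (0, x) - 1) <= 2 * x.
Proof.
intros Hx; eapply Rle_trans; [apply Cmod_le_Rabs|]; unfold Cexp; simpl; rewrite exp_0.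
generalize PI2_1; intro HPI.
assert (H1 : 0 <= sin x <= x).
{ split; [apply sin_ge_0; lra|apply Rlt_le, sin_lt_x; lra]. }
assert (H2 : 0 <= sin (x / 2) <= x / 2).
{ split; [apply sin_ge_0; lra|apply Rlt_le, sin_lt_x; lra]. }
replace (cos x) with (1 - 2 * sin (x / 2) * sin (x / 2))
  by (rewrite <- cos_2a_sin; f_equal; field).
replace (1 * (1 - 2 * sin (x / 2) * sin (x / 2)) + - (1)) with
  (- (2 * (sin (x / 2) * sin (x / 2)))) by ring.
rewrite Rabs_Ropp, !Rabs_pos_eq by nra. nra.
Qed.

Lemma Cexp_rotation_neq_1 x : 0 < x < 1 -> Cexp (0, 2 * PI * x) <> RtoC 1.
Proof.
intros Hx H; injection H; simpl; rewrite exp_0; intros _ Hc.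
replace (2 * PI * x) with (2 * (PI * x)) in Hc by ring.
rewrite cos_2a_sin in Hc.
assert (0 < sin (PI * x)); [|nra].
generalize PI_RGT_0; intro; apply sin_gt_0; nra.
Qed.

(** A power lam^n = 1 would give lam^(n q_k) = 1 for k = n, where n q_k alpha
    differs from an integer by an amount strictly between 0 and 1. *)
Lemma exists_liouville_multiplier : exists lam : C, liouville_multiplier lam.
Proof.
destruct exists_liouville_angle as [alpha Ha].
exists (Cexp (0, 2 * PI * alpha)); split; [|split].
- rewrite Cmod_Cexp; apply exp_0.
- intros n Hn H1.
  destruct (Ha n) as [p [delta [Hp Hd]]].
  destruct (liouville_factor_bounds n (liouville_den n)) as [B1 [B2 _]].
  set (q := liouville_den n) in *; set (m := INR (liouville_factor n q)) in *.
  assert (Hn1 : 1 <= INR n) by (apply (le_INR 1), Hn).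
  apply (Cexp_rotation_neq_1 (INR n * delta)).
  + split; [apply Rmult_lt_0_compat; lra|].
    apply Rle_lt_trans with (INR n * (2 / m)); [apply Rmult_le_compat_l; lra|].
    apply Rmult_lt_reg_r with m; [lra|]. field_simplify; lra.
  + rewrite <- (Cexp_rotation_turns (n * p)), mult_INR, <- Rmult_plus_distr_l, <- Hp.
    replace (2 * PI * (INR n * (INR q * alpha))) with (INR (n * q) * (2 * PI * alpha))
      by (rewrite mult_INR; ring).
    rewrite <- Cexp_rotation_pow, Cpow_mult_r, H1; apply Cpow_1_l.
- intro K.
  destruct (archimed K) as [HK _].
  set (k := Z.to_nat (up K)).
  assert (HkK : K <= INR k).
  { destruct (Z_lt_le_dec (up K) 0) as [Hneg|Hpos].
    - generalize (pos_INR k); assert (IZR (up K) < 0) by (apply IZR_lt; trivial); lra.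
    - unfold k; rewrite INR_IZR_INZ, Z2Nat.id by trivial; lra. }
  exists (liouville_den k); split; [apply liouville_den_pos|].
  destruct (Ha k) as [p [delta [Hp Hd]]].
  destruct (liouville_factor_bounds k (liouville_den k)) as [B1 [_ B3]].
  set (q := liouville_den k) in *; set (m := INR (liouville_factor k q)) in *.
  rewrite Cexp_rotation_pow.
  replace (INR q * (2 * PI * alpha)) with (2 * PI * (INR p + delta)) by (rewrite <- Hp; ring).
  rewrite Cexp_rotation_turns.
  set (E := INR k * 2 ^ q) in *.
  assert (HE : 0 <= E).
  { unfold E; apply Rmult_le_pos; [apply pos_INR|apply pow_le; lra]. }
  assert (HE1 : 1 <= exp E) by (rewrite <- exp_0; destruct HE as [HE|<-]; [apply Rlt_le, exp_increasing, HE|lra]).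
  generalize PI_RGT_0; intro HPI.
  assert (Hmd : m * delta <= 2).
  { replace 2 with (m * (2 / m)) by (field; lra). apply Rmult_le_compat_l; lra. }
  assert (Hsmall : 2 * (2 * PI * delta) <= exp (- E)).
  { rewrite exp_Ropp; apply Rmult_le_reg_r with (exp E); [lra|].
    rewrite Rinv_l by lra.
    assert (8 * PI * exp E * delta <= m * delta) by (apply Rmult_le_compat_r; lra). nra. }
  assert (exp (- E) <= 1).
  { rewrite <- exp_0; destruct (Rle_lt_or_eq_dec 0 E HE) as [H|<-];
      [apply Rlt_le, exp_increasing; lra|rewrite Ropp_0; lra]. }
  eapply Rle_trans; [apply Cexp_rotation_near_1|].
  + split; [nra|]. lra.
  + apply Rle_trans with (1 := Hsmall).
    assert (- E <= - K * 2 ^ q) as [H'|H'].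
    { unfold E; generalize (pow_le 2 q ltac:(lra)); nra. }
    * apply Rlt_le, exp_increasing, H'.
    * rewrite H'; lra.
Qed.

(** * Norms and escape rates *)
Definition max_norm (u : C * C) : R := Rmax (Cmod (fst u)) (Cmod (snd u)).

Definition C2_scal (k : C) (u : C * C) : C * C := ((k * fst u)%C, (k * snd u)%C).

Lemma max_norm_scal k u : max_norm (C2_scal k u) = Cmod k * max_norm u.
Proof.
unfold max_norm, C2_scal; simpl; rewrite !Cmod_mult.
apply RmaxRmult, Cmod_ge_0.
Qed.

Lemma max_norm_pos u : 0 < max_norm u <-> u <> C2_zero.
Proof.
destruct u as [z w]; unfold max_norm, C2_zero; simpl; split.
- intros H [= -> ->]; rewrite Cmod_0, Rmax_left in H; lra.
- intro H; destruct (Ceq_dec z 0) as [->|Hz].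
  + destruct (Ceq_dec w 0) as [->|Hw]; [now elim H|].
    apply Rlt_le_trans with (2 := Rmax_r _ _), Cmod_gt_0, Hw.
  + apply Rlt_le_trans with (2 := Rmax_l _ _), Cmod_gt_0, Hz.
Qed.

Lemma C2_norm_max_norm u : max_norm u <= C2_norm u <= 2 * max_norm u.
Proof.
destruct u as [z w]; unfold max_norm; simpl fst; simpl snd.
change (C2_norm (z, w)) with (sqrt (Cmod z ^ 2 + Cmod w ^ 2)).
generalize (Cmod_ge_0 z) (Cmod_ge_0 w) (Rmax_l (Cmod z) (Cmod w)) (Rmax_r (Cmod z) (Cmod w)); intros.
set (m := Rmax (Cmod z) (Cmod w)) in *.
split.
- apply Rmax_lub.
  + rewrite <- (sqrt_pow2 (Cmod z)) at 1 by trivial; apply sqrt_le_1_alt; nra.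
  + rewrite <- (sqrt_pow2 (Cmod w)) at 1 by trivial; apply sqrt_le_1_alt; nra.
- rewrite <- (sqrt_pow2 (2 * m)) by lra; apply sqrt_le_1_alt; nra.
Qed.

Lemma escape_rate_max_norm d F u G : (1 < d)%nat ->
  (forall n, Nat.iter n F u <> C2_zero) ->
  is_escape_rate d F u G <->
  is_lim_seq (fun n => ln (max_norm (Nat.iter n F u)) / INR d ^ n) G.
Proof.
intros Hd Hnz; unfold is_escape_rate.
assert (Hd1 : 1 < INR d) by (apply (lt_INR 1), Hd).
assert (Hpow : forall n, 0 < INR d ^ n) by (intro n; apply pow_lt; lra).
set (a := fun n => ln (max_norm (Nat.iter n F u)) / INR d ^ n).
set (b := fun n => ln (C2_norm (Nat.iter n F u)) / INR d ^ n).
assert (Hdiff : is_lim_seq (fun n => b n - a n) 0).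
{ apply is_lim_seq_le_le with (fun _ => 0) (fun n => ln 2 * (/ INR d) ^ n).
  - intro n; unfold a, b.
    generalize (C2_norm_max_norm (Nat.iter n F u)) (proj2 (max_norm_pos _) (Hnz n)).
    set (M := max_norm _); set (N := C2_norm _); intros [HN1 HN2] HM.
    assert (ln M <= ln N) by (apply ln_le; trivial).
    assert (ln N <= ln 2 + ln M) by (rewrite <- ln_mult by lra; apply ln_le; lra).
    assert (0 < / INR d ^ n) by (apply Rinv_0_lt_compat, Hpow).
    rewrite pow_inv; unfold Rdiv; split; nra.
  - apply is_lim_seq_const.
  - replace (Finite 0) with (Rbar_mult (ln 2) 0) by (simpl; f_equal; ring).
    apply is_lim_seq_scal_l, is_lim_seq_geom.
    rewrite Rabs_pos_eq; [rewrite <- Rinv_1; apply Rinv_lt_contravar; lra|].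
    apply Rlt_le, Rinv_0_lt_compat; lra. }
split; intro H.
- apply is_lim_seq_ext with (fun n => b n - (b n - a n)); [intro n; ring|].
  replace (Finite G) with (Finite (G - 0)) by (f_equal; ring).
  apply is_lim_seq_minus'; assumption.
- apply is_lim_seq_ext with (fun n => a n + (b n - a n)); [intro n; ring|].
  replace (Finite G) with (Finite (G + 0)) by (f_equal; ring).
  apply is_lim_seq_plus'; assumption.
Qed.

(** The sequences (u n - B) / 2^n and (u n + A) / 2^n are monotone and enclose the
    limit. *)
Lemma almost_doubling_limit (u : nat -> R) A B : 0 <= A + B ->
  (forall n, 2 * u n - B <= u (S n) <= 2 * u n + A) ->
  exists G : R, is_lim_seq (fun n => u n / 2 ^ n) G /\
    forall n, (u n - B) / 2 ^ n <= G <= (u n + A) / 2 ^ n.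
Proof.
intros HAB Hu.
assert (Hpow : forall n, 0 < / 2 ^ n) by (intro n; apply Rinv_0_lt_compat, pow_lt; lra).
assert (HpowS : forall n, / 2 ^ n = 2 * / 2 ^ S n).
{ intro n; simpl; field; apply pow_nonzero; lra. }
destruct (nested_halves (fun n => (u n - B) / 2 ^ n) (fun n => (u n + A) / 2 ^ n)) as [G HG].
- intro n; unfold Rdiv; apply Rmult_le_compat_r; [apply Rlt_le, Hpow|lra].
- intro n; unfold Rdiv; rewrite (HpowS n); generalize (Hpow (S n)) (Hu n); intros; nra.
- intro n; unfold Rdiv; rewrite (HpowS n); generalize (Hpow (S n)) (Hu n); intros; nra.
- exists G; split; trivial.
  assert (Hgeom : forall c, is_lim_seq (fun n => G + c * (/ 2) ^ n) G).
  { intro c; replace (Finite G) with (Finite (G + c * 0)) by (f_equal; ring).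
    apply is_lim_seq_plus'; [apply is_lim_seq_const|].
    apply (is_lim_seq_scal_l (fun n => (/ 2) ^ n) c 0), is_lim_seq_geom.
    rewrite Rabs_pos_eq; lra. }
  apply is_lim_seq_le_le with (2 := Hgeom (- A)) (3 := Hgeom B).
  intro n; generalize (HG n) (Hpow n); rewrite pow_inv; unfold Rdiv; intros; nra.
Qed.

(** * The degenerating family *)
Definition rotation_map (lam t : C) (u : C * C) : C * C :=
  ((lam * (fst u * (fst u - snd u)))%C,
   (snd u * (fst u - snd u) + t * (fst u * fst u))%C).

Lemma rotation_map_scal lam t k u :
  rotation_map lam t (C2_scal k u) = C2_scal (k * k) (rotation_map lam t u).
Proof. unfold rotation_map, C2_scal; simpl; f_equal; ring. Qed.

Lemma rotation_map_upper lam t u : Cmod lam = 1 -> Cmod t <= 1 ->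
  max_norm (rotation_map lam t u) <= 3 * max_norm u ^ 2.
Proof.
intros Hl Ht; destruct u as [z w]; unfold max_norm, rotation_map; simpl fst; simpl snd.
set (m := Rmax (Cmod z) (Cmod w)).
generalize (Cmod_ge_0 z) (Cmod_ge_0 w) (Cmod_ge_0 t) (Rmax_l (Cmod z) (Cmod w))
  (Rmax_r (Cmod z) (Cmod w)); fold m; intros Z0 W0 T0 Zm Wm.
assert (Hd : Cmod (z - w) <= 2 * m).
{ eapply Rle_trans; [apply Cmod_triangle|]; rewrite Cmod_opp; lra. }
assert (D0 := Cmod_ge_0 (z - w)).
apply Rmax_lub.
- rewrite !Cmod_mult, Hl; nra.
- eapply Rle_trans; [apply Cmod_triangle|]; rewrite !Cmod_mult.
  assert (Cmod w * Cmod (z - w) <= m * (2 * m)) by (apply Rmult_le_compat; lra).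
  assert (Cmod z * Cmod z <= m * m) by (apply Rmult_le_compat; lra).
  assert (Cmod t * (Cmod z * Cmod z) <= 1 * (m * m)) by (apply Rmult_le_compat; nra).
  lra.
Qed.

(** With X = z (z - w) and Y = w (z - w) + t z^2, the resultant identities
    t z^3 = z Y - w X and t w^3 = (1 + t) t z^3 - t ((1 + t) z X + w X + w Y)
    bound the cube of the larger coordinate. *)
Lemma rotation_map_lower lam t u : Cmod lam = 1 -> Cmod t <= 1 ->
  Cmod t * max_norm u ^ 2 <= 8 * max_norm (rotation_map lam t u).
Proof.
intros Hl Ht; destruct u as [z w].
set (X := (z * (z - w))%C); set (Y := (w * (z - w) + t * (z * z))%C).
set (m := max_norm (z, w)); set (M := max_norm (rotation_map lam t (z, w))).
assert (HX : Cmod X <= M).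
{ replace (Cmod X) with (Cmod (lam * X)) by (rewrite Cmod_mult, Hl; ring). apply Rmax_l. }
assert (HY : Cmod Y <= M) by apply Rmax_r.
assert (Hz : Cmod z <= m) by apply Rmax_l.
assert (Hw : Cmod w <= m) by apply Rmax_r.
assert (Z0 := Cmod_ge_0 z). assert (W0 := Cmod_ge_0 w). assert (T0 := Cmod_ge_0 t).
assert (X0 := Cmod_ge_0 X). assert (Y0 := Cmod_ge_0 Y).
assert (HZX : Cmod z * Cmod X <= m * M) by (apply Rmult_le_compat; lra).
assert (HZY : Cmod z * Cmod Y <= m * M) by (apply Rmult_le_compat; lra).
assert (HWX : Cmod w * Cmod X <= m * M) by (apply Rmult_le_compat; lra).
assert (HWY : Cmod w * Cmod Y <= m * M) by (apply Rmult_le_compat; lra).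
assert (Hz3 : (t * (z * (z * z)) = z * Y - w * X)%C) by (unfold X, Y; ring).
assert (Hw3 : (t * (w * (w * w)) =
   (1 + t) * (t * (z * (z * z))) - t * ((1 + t) * (z * X) + w * X + w * Y))%C)
  by (unfold X, Y; ring).
assert (B1 : Cmod (t * (z * (z * z))) <= 2 * (m * M)).
{ rewrite Hz3; eapply Rle_trans; [apply Cmod_triangle|].
  rewrite Cmod_opp, !Cmod_mult; lra. }
assert (H1t : Cmod (1 + t) <= 2).
{ eapply Rle_trans; [apply Cmod_triangle|]; rewrite Cmod_1; lra. }
assert (B2 : Cmod (t * (w * (w * w))) <= 8 * (m * M)).
{ rewrite Hw3; eapply Rle_trans; [apply Cmod_triangle|].
  rewrite Cmod_opp, (Cmod_mult (1 + t)), (Cmod_mult t ((1 + t) * (z * X) + w * X + w * Y)).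
  assert (C1 : Cmod ((1 + t) * (z * X) + w * X + w * Y) <= 4 * (m * M)).
  { eapply Rle_trans; [apply Cmod_triangle|].
    eapply Rle_trans; [apply Rplus_le_compat_r, Cmod_triangle|].
    rewrite !Cmod_mult.
    assert (Cmod (1 + t) * (Cmod z * Cmod X) <= 2 * (m * M))
      by (apply Rmult_le_compat; try apply Cmod_ge_0; nra).
    lra. }
  assert (Cmod (1 + t) * Cmod (t * (z * (z * z))) <= 2 * (2 * (m * M)))
    by (apply Rmult_le_compat; try apply Cmod_ge_0; lra).
  assert (Cmod t * Cmod ((1 + t) * (z * X) + w * X + w * Y) <= 1 * (4 * (m * M)))
    by (apply Rmult_le_compat; try apply Cmod_ge_0; lra).
  lra. }
rewrite !Cmod_mult in B1, B2.
assert (M0 : 0 <= M) by lra.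
assert (Hcase : m = Cmod z \/ m = Cmod w).
{ unfold m, max_norm, Rmax; simpl; destruct Rle_dec; auto. }
destruct (Req_dec m 0) as [Hm|Hm]; [rewrite Hm; lra|].
apply Rmult_le_reg_l with m; [lra|].
destruct Hcase as [E|E]; rewrite <- E in *; nra.
Qed.

Lemma max_norm_zero : max_norm C2_zero = 0.
Proof. unfold max_norm, C2_zero; simpl; rewrite Cmod_0; apply Rmax_left; lra. Qed.

Lemma rotation_map_nonzero lam t u : Cmod lam = 1 -> 0 < Cmod t <= 1 ->
  u <> C2_zero -> rotation_map lam t u <> C2_zero.
Proof.
intros Hl Ht Hu H.
apply max_norm_pos in Hu.
generalize (rotation_map_lower lam t u Hl ltac:(lra)); rewrite H, max_norm_zero.
assert (0 < Cmod t * max_norm u ^ 2) by (apply Rmult_lt_0_compat; nra). lra.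
Qed.

Definition rotation_orbit (lam t : C) (n : nat) : C * C :=
  Nat.iter n (rotation_map lam t) (lam, RtoC 1).

Lemma rotation_orbit_nonzero lam t n : Cmod lam = 1 -> 0 < Cmod t <= 1 ->
  rotation_orbit lam t n <> C2_zero.
Proof.
intros Hl Ht; induction n.
- intros [= _ H]; revert H; apply R1_neq_R0.
- apply rotation_map_nonzero; trivial.
Qed.

Definition rotation_escape (lam t : C) : R :=
  real (Lim_seq (fun n => ln (max_norm (rotation_orbit lam t n)) / 2 ^ n)).

Lemma rotation_escape_spec lam t : Cmod lam = 1 -> 0 < Cmod t <= 1 ->
  is_lim_seq (fun n => ln (max_norm (rotation_orbit lam t n)) / 2 ^ n) (rotation_escape lam t) /\
  forall n, (ln (max_norm (rotation_orbit lam t n)) - (ln 8 - ln (Cmod t))) / 2 ^ n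
     <= rotation_escape lam t <= (ln (max_norm (rotation_orbit lam t n)) + ln 3) / 2 ^ n.
Proof.
intros Hl Ht.
set (u := fun n => ln (max_norm (rotation_orbit lam t n))).
assert (Ht0 : ln (Cmod t) <= 0) by (rewrite <- ln_1; apply ln_le; lra).
assert (H3 : 0 < ln 3) by (rewrite <- ln_1; apply ln_increasing; lra).
assert (H8 : 0 < ln 8) by (rewrite <- ln_1; apply ln_increasing; lra).
destruct (almost_doubling_limit u (ln 3) (ln 8 - ln (Cmod t))) as [G [HG1 HG2]]; [lra| |].
- intro n; unfold u.
  assert (Pn := proj2 (max_norm_pos _) (rotation_orbit_nonzero lam t n Hl Ht)).
  assert (PS := proj2 (max_norm_pos _) (rotation_orbit_nonzero lam t (S n) Hl Ht)).
  assert (U := rotation_map_upper lam t (rotation_orbit lam t n) Hl ltac:(lra)).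
  assert (L := rotation_map_lower lam t (rotation_orbit lam t n) Hl ltac:(lra)).
  change (rotation_map lam t (rotation_orbit lam t n)) with (rotation_orbit lam t (S n)) in U, L.
  set (M := max_norm (rotation_orbit lam t n)) in *.
  set (M' := max_norm (rotation_orbit lam t (S n))) in *.
  assert (HM : ln (M ^ 2) = 2 * ln M) by (simpl; rewrite Rmult_1_r, ln_mult by trivial; ring).
  assert (HM2 : 0 < M ^ 2) by (apply pow_lt, Pn).
  apply ln_le in U; [|trivial]; apply ln_le in L; [|apply Rmult_lt_0_compat; lra].
  rewrite ln_mult, HM in U by lra. rewrite !ln_mult, HM in L by lra. lra.
- assert (E : rotation_escape lam t = G).
  { change (rotation_escape lam t) with (real (Lim_seq (fun n => u n / 2 ^ n))); rewrite (is_lim_seq_unique _ _ HG1); reflexivity. }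
  rewrite E; split; trivial.
Qed.

Lemma rotation_orbit_holomorphic lam n t :
  C_ex_derive (fun t => fst (rotation_orbit lam t n)) t /\
  C_ex_derive (fun t => snd (rotation_orbit lam t n)) t.
Proof.
induction n as [|n [IH1 IH2]].
- split; [exact (C_ex_derive_const lam t)|exact (C_ex_derive_const (RtoC 1) t)].
- set (z := fun t => fst (rotation_orbit lam t n)) in *.
  set (w := fun t => snd (rotation_orbit lam t n)) in *.
  assert (Hd : C_ex_derive (fun t => (z t - w t)%C) t)
    by (exact (ex_derive_minus (K := C_AbsRing) (V := C_NormedModule) z w t IH1 IH2)).
  split.
  + change (C_ex_derive (fun t => (lam * (z t * (z t - w t)))%C) t).
    apply C_ex_derive_mult; [apply C_ex_derive_const|].
    apply (C_ex_derive_mult z); trivial.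
  + change (C_ex_derive (fun t => (w t * (z t - w t) + t * (z t * z t))%C) t).
    apply C_ex_derive_plus; [apply (C_ex_derive_mult w); trivial|].
    apply C_ex_derive_mult; [apply C_ex_derive_id|apply (C_ex_derive_mult z); trivial].
Qed.

Lemma Cmod_lipschitz z w : Rabs (Cmod z - Cmod w) <= Cmod (z - w).
Proof.
apply Rabs_le; split.
- generalize (Cmod_triangle z (w - z)); replace (z + (w - z))%C with w by ring.
  replace (w - z)%C with (- (z - w))%C by ring; rewrite Cmod_opp; lra.
- generalize (Cmod_triangle w (z - w)); replace (w + (z - w))%C with z by ring; lra.
Qed.

Lemma rotation_orbit_near_0 lam n : 0 < max_norm (rotation_orbit lam 0 n) ->
  exists del, 0 < del /\ forall t, Cmod t < del ->
    max_norm (rotation_orbit lam 0 n) / 2 <= max_norm (rotation_orbit lam t n)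
    <= 2 * max_norm (rotation_orbit lam 0 n).
Proof.
intros HM; set (M := max_norm (rotation_orbit lam 0 n)) in *.
destruct (rotation_orbit_holomorphic lam n (RtoC 0)) as [H1 H2].
destruct (C_ex_derive_eps_continuous _ _ H1 (M / 2)) as [d1 [D1 E1]]; [lra|].
destruct (C_ex_derive_eps_continuous _ _ H2 (M / 2)) as [d2 [D2 E2]]; [lra|].
exists (Rmin d1 d2); split; [apply Rmin_glb_lt; trivial|].
intros t Ht; apply Rmin_Rgt_l in Ht; destruct Ht as [T1 T2].
assert (Ht0 : (t - 0)%C = t) by ring.
specialize (E1 t); specialize (E2 t); rewrite Ht0 in E1, E2.
specialize (E1 T1); specialize (E2 T2).
assert (F1 := Rle_lt_trans _ _ _ (Cmod_lipschitz _ _) E1).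
assert (F2 := Rle_lt_trans _ _ _ (Cmod_lipschitz _ _) E2).
apply Rabs_lt_between in F1; apply Rabs_lt_between in F2.
assert (HM' : M = Rmax (Cmod (fst (rotation_orbit lam 0 n))) (Cmod (snd (rotation_orbit lam 0 n)))) by reflexivity.
generalize (Rmax_l (Cmod (fst (rotation_orbit lam 0 n))) (Cmod (snd (rotation_orbit lam 0 n))))
 (Rmax_r (Cmod (fst (rotation_orbit lam 0 n))) (Cmod (snd (rotation_orbit lam 0 n)))).
rewrite <- HM'; intros.
split.
- unfold max_norm at 1; fold M.
  generalize (Rmax_l (Cmod (fst (rotation_orbit lam t n))) (Cmod (snd (rotation_orbit lam t n))))
   (Rmax_r (Cmod (fst (rotation_orbit lam t n))) (Cmod (snd (rotation_orbit lam t n)))); intros.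
  revert HM'; unfold Rmax at 1; destruct Rle_dec; intro HM'; lra.
- apply Rmax_lub; lra.
Qed.

(** At t = 0 each step squares the scalar in front of the rotated point (lam^(n+1), 1)
    and multiplies it by the value lam^(n+1) - 1 of z - w there:
    F_0^n (lam, 1) = [hole_factor] n * (lam^(n+1), 1). *)
Fixpoint hole_factor (lam : C) (n : nat) : C :=
  match n with
  | O => RtoC 1
  | S n => (hole_factor lam n * hole_factor lam n * (lam ^ S n - 1))%C
  end.

Lemma rotation_orbit_0 lam n :
  rotation_orbit lam 0 n = ((hole_factor lam n * lam ^ S n)%C, hole_factor lam n).
Proof.
induction n.
- unfold rotation_orbit; simpl; f_equal; ring.
- change (rotation_orbit lam 0 (S n)) with (rotation_map lam 0 (rotation_orbit lam 0 n)).
  rewrite IHn; unfold rotation_map; simpl; f_equal; ring.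
Qed.

Lemma max_norm_rotation_orbit_0 lam n : Cmod lam = 1 ->
  max_norm (rotation_orbit lam 0 n) = Cmod (hole_factor lam n).
Proof.
intro Hl; rewrite rotation_orbit_0.
change (Rmax (Cmod (hole_factor lam n * lam ^ S n)) (Cmod (hole_factor lam n)) = Cmod (hole_factor lam n)).
rewrite Cmod_mult, Cmod_pow, Hl, pow1, Rmult_1_r; apply Rmax_left; lra.
Qed.

Lemma hole_factor_nonzero lam n : (forall n, (1 <= n)%nat -> (lam ^ n)%C <> RtoC 1) ->
  0 < Cmod (hole_factor lam n).
Proof.
intros Hl; induction n.
- simpl; rewrite Cmod_1; lra.
- change (hole_factor lam (S n)) with (hole_factor lam n * hole_factor lam n * (lam ^ S n - 1))%C.
  rewrite !Cmod_mult; repeat apply Rmult_lt_0_compat; trivial.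
  apply Cmod_gt_0; intro H; apply (Hl (S n)); [lia|].
  replace (lam ^ S n)%C with ((lam ^ S n - 1) + 1)%C by ring; rewrite H; ring.
Qed.

Lemma hole_factor_le lam n : Cmod lam = 1 -> Cmod (hole_factor lam n) <= exp (ln 2 * (2 ^ n - 1)).
Proof.
intros Hl; induction n.
- simpl; rewrite Cmod_1, Rminus_diag, Rmult_0_r, exp_0; lra.
- change (hole_factor lam (S n)) with (hole_factor lam n * hole_factor lam n * (lam ^ S n - 1))%C.
  rewrite !Cmod_mult.
  assert (Cmod (lam ^ S n - 1) <= 2).
  { eapply Rle_trans; [apply Cmod_triangle|].
    rewrite Cmod_opp, Cmod_1, Cmod_pow, Hl, pow1; lra. }
  replace (exp (ln 2 * (2 ^ S n - 1))) with (exp (ln 2 * (2 ^ n - 1)) * exp (ln 2 * (2 ^ n - 1)) * 2).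
  + apply Rmult_le_compat; trivial; try (apply Rmult_le_pos); try apply Cmod_ge_0.
    apply Rmult_le_compat; trivial; apply Cmod_ge_0.
  + rewrite <- (exp_ln 2) at 5 by lra. rewrite <- !exp_plus; f_equal; simpl; ring.
Qed.

(** A single n at which lam^(n+1) is close enough to 1 makes
    2^(-n-1) log |F_0^(n+1) (lam, 1)| smaller than a prescribed bound, and this passes to small t by
    continuity and to G by the upper estimate of [rotation_escape_spec]. *)
Lemma rotation_escape_minus_infty lam : liouville_multiplier lam ->
  forall K, exists del, 0 < del /\ forall t, 0 < Cmod t < del -> rotation_escape lam t <= - K.
Proof.
intros [Hl [Hirr Hliou]] K.
assert (Hln : 0 < ln 2) by (rewrite <- ln_1; apply ln_increasing; lra).
assert (H3 : 0 < ln 3) by (rewrite <- ln_1; apply ln_increasing; lra).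
destruct (Hliou (K + 2 * ln 2 + ln 3)) as [[|n] [Hn Hclose]]; [lia|].
set (M := max_norm (rotation_orbit lam 0 (S n))).
assert (HM : 0 < M).
{ unfold M; rewrite max_norm_rotation_orbit_0 by trivial; apply hole_factor_nonzero, Hirr. }
assert (HMle : ln M <= (ln 2 - (K + 2 * ln 2 + ln 3)) * 2 ^ S n).
{ unfold M; rewrite max_norm_rotation_orbit_0 by trivial.
  rewrite <- (ln_exp ((ln 2 - _) * _)); apply ln_le; [apply hole_factor_nonzero, Hirr|].
  change (hole_factor lam (S n)) with (hole_factor lam n * hole_factor lam n * (lam ^ S n - 1))%C.
  rewrite !Cmod_mult.
  assert (Hc := hole_factor_le lam n Hl).
  set (E := ln 2 * (2 ^ n - 1)) in *; set (E' := - (K + 2 * ln 2 + ln 3) * 2 ^ S n) in *.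
  apply Rle_trans with (exp E * exp E * exp E').
  - apply Rmult_le_compat; trivial; try (apply Rmult_le_pos); try apply Cmod_ge_0.
    apply Rmult_le_compat; trivial; apply Cmod_ge_0.
  - rewrite <- !exp_plus; apply Rlt_le, exp_increasing; unfold E, E'; simpl; lra. }
destruct (rotation_orbit_near_0 lam (S n) HM) as [del [Hdel Hnear]].
exists (Rmin del 1); split; [apply Rmin_glb_lt; lra|].
intros t [Ht0 Ht]; apply Rmin_Rgt_l in Ht; destruct Ht as [Ht Ht1].
destruct (rotation_escape_spec lam t Hl ltac:(lra)) as [_ Hb].
eapply Rle_trans; [apply (Hb (S n))|].
assert (Hpow : 1 <= 2 ^ S n) by (apply pow_R1_Rle; lra).
assert (HL : ln (max_norm (rotation_orbit lam t (S n))) <= ln 2 + ln M).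
{ rewrite <- ln_mult by lra; apply ln_le; [apply max_norm_pos, rotation_orbit_nonzero; trivial; lra|].
  apply Hnear, Ht. }
apply Rmult_le_reg_r with (2 ^ S n); [lra|].
unfold Rdiv; rewrite Rmult_assoc, Rinv_l, Rmult_1_r by lra.
nra.
Qed.

(** For large n, the term 2^(-n) log |t| of the lower estimate is small compared with
    log |t|, and for this n the rest of the estimate stays bounded as t -> 0. *)
Lemma rotation_escape_little_o lam : liouville_multiplier lam ->
  forall eps, 0 < eps -> exists del, 0 < del /\ forall t, 0 < Cmod t < del ->
    Rabs (rotation_escape lam t) <= eps * Rabs (ln (Cmod t)).
Proof.
intros Hlam eps Heps.
assert (Hl := proj1 Hlam); assert (Hirr := proj1 (proj2 Hlam)).
destruct (rotation_escape_minus_infty lam Hlam 0) as [d1 [D1 H1]].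
destruct (pow_lt_1_zero (/ 2) ltac:(rewrite Rabs_pos_eq; lra) (eps / 2)) as [n Hn]; [lra|].
specialize (Hn n (le_n n)); rewrite Rabs_pos_eq, pow_inv in Hn by (apply pow_le; lra).
set (M := max_norm (rotation_orbit lam 0 n)).
assert (HM : 0 < M).
{ unfold M; rewrite max_norm_rotation_orbit_0 by trivial; apply hole_factor_nonzero, Hirr. }
destruct (rotation_orbit_near_0 lam n HM) as [d2 [D2 Hnear]].
set (c := Rabs (ln (M / 2)) + ln 8).
assert (H8 : 0 < ln 8) by (rewrite <- ln_1; apply ln_increasing; lra).
assert (Hc : 0 < c) by (unfold c; generalize (Rabs_pos (ln (M / 2))); lra).
exists (Rmin (Rmin d1 d2) (exp (- (2 * c / eps)))); split.
{ repeat apply Rmin_glb_lt; trivial; apply exp_pos. }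
intros t [Ht0 Ht]; apply Rmin_Rgt_l in Ht; destruct Ht as [Ht Ht3].
apply Rmin_Rgt_l in Ht; destruct Ht as [Ht1 Ht2].
assert (Hce : 0 < 2 * c / eps) by (apply Rdiv_lt_0_compat; lra).
assert (Hlt : ln (Cmod t) < - (2 * c / eps)) by (rewrite <- ln_exp; apply ln_increasing; lra).
assert (Ht1' : Cmod t <= 1).
{ apply Rlt_le, Rlt_le_trans with (1 := Ht3); rewrite <- exp_0; apply Rlt_le, exp_increasing; lra. }
specialize (H1 t (conj Ht0 Ht1)); rewrite Ropp_0 in H1.
destruct (rotation_escape_spec lam t Hl ltac:(lra)) as [_ Hb].
specialize (Hb n); destruct Hb as [Hb _].
assert (HL : ln (M / 2) <= ln (max_norm (rotation_orbit lam t n))) by (apply ln_le; [lra|apply Hnear, Ht2]).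
rewrite (Rabs_left1 (rotation_escape lam t)), (Rabs_left (ln (Cmod t))) by lra.
assert (Hp : 0 < / 2 ^ n <= 1).
{ split; [apply Rinv_0_lt_compat, pow_lt; lra|].
  rewrite <- Rinv_1; apply Rinv_le_contravar; [lra|apply pow_R1_Rle; lra]. }
unfold Rdiv at 1 in Hb.
set (p := / 2 ^ n) in *.
generalize (Rle_abs (- ln (M / 2))); rewrite Rabs_Ropp; intro Ha.
assert (Hcl : c < eps / 2 * - ln (Cmod t)).
{ replace c with (eps / 2 * (2 * c / eps)) by (field; lra). apply Rmult_lt_compat_l; lra. }
assert ((- c + ln (Cmod t)) * p <= (ln (max_norm (rotation_orbit lam t n)) - (ln 8 - ln (Cmod t))) * p).
{ apply Rmult_le_compat_r; unfold c; lra. }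
assert (c * p <= c) by nra.
assert (- ln (Cmod t) * p <= - ln (Cmod t) * (eps / 2)) by (apply Rmult_le_compat_l; lra).
lra.
Qed.

(** * Behaviour near the puncture *)
Lemma locally'_0_C (P : C -> Prop) :
  locally' (RtoC 0 : C_UniformSpace) P <->
  exists del, 0 < del /\ forall t, 0 < Cmod t < del -> P t.
Proof.
split.
- intros [del Hdel]; exists del; split; [apply cond_pos|].
  intros t [Ht0 Ht]; apply Hdel; [|apply Cmod_gt_0, Ht0].
  apply C_NormedModule_mixin_compat1.
  replace (minus t (RtoC 0)) with t; [exact Ht|].
  unfold minus, plus, opp; simpl; unfold Cplus, Copp; simpl; destruct t; simpl; f_equal; ring.
- intros [del [Hdel H]].
  assert (Hd2 : 0 < del / 2) by lra.
  exists (mkposreal _ Hd2); intros t Ht Ht0; apply H; split; [apply Cmod_gt_0, Ht0|].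
  destruct Ht as [Ht1 Ht2].
  eapply Rle_lt_trans; [apply Cmod_le_Rabs|].
  unfold ball in Ht1, Ht2; simpl in Ht1, Ht2; unfold AbsRing_ball, abs, minus, plus, opp in Ht1, Ht2.
  simpl in Ht1, Ht2; rewrite Ropp_0, Rplus_0_r in Ht1, Ht2; lra.
Qed.

Lemma limsup_m_infty {T} (F : (T -> Prop) -> Prop) (g : T -> R) :
  (forall K, F (fun t => g t <= - K)) -> limsup F g = m_infty.
Proof.
intros H; apply Rbar_is_glb_unique; split.
- intros s _; exact I.
- intros b Hb; destruct b as [b| |].
  + specialize (Hb _ (ex_intro _ _ (conj (H (1 - b)) eq_refl))).
    assert (Hl : Rbar_le (Lub_Rbar (fun y => exists t, g t <= - (1 - b) /\ y = g t)) (- (1 - b))).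
    { apply (proj2 (Lub_Rbar_correct _)); intros y [t [Ht ->]]; exact Ht. }
    assert (Hb' := Rbar_le_trans _ _ _ Hb Hl); simpl in Hb'; exfalso; lra.
  + specialize (Hb _ (ex_intro _ _ (conj (H 0) eq_refl))).
    assert (Hl : Rbar_le (Lub_Rbar (fun y => exists t, g t <= - 0 /\ y = g t)) (- 0)).
    { apply (proj2 (Lub_Rbar_correct _)); intros y [t [Ht ->]]; exact Ht. }
    exact (Rbar_le_trans _ _ _ Hb Hl).
  + exact I.
Qed.

Lemma exists_small_point (d : R) : 0 < d -> exists t : C, 0 < Cmod t < d.
Proof.
intro Hd; exists (RtoC (d / 2)); rewrite Cmod_R, Rabs_pos_eq; lra.
Qed.

Lemma tends_to_m_infty_not_bounded (g : C -> R) :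
  (forall K, exists del, 0 < del /\ forall t, 0 < Cmod t < del -> g t <= - K) ->
  ~ bounded_below_near_0 g.
Proof.
intros H [M HM]; apply locally'_0_C in HM; destruct HM as [d1 [D1 H1]].
destruct (H (1 - M)) as [d2 [D2 H2]].
destruct (exists_small_point (Rmin d1 d2)) as [t [Ht0 Ht]]; [apply Rmin_glb_lt; trivial|].
apply Rmin_Rgt_l in Ht; destruct Ht.
specialize (H1 t ltac:(lra)); specialize (H2 t ltac:(lra)); lra.
Qed.

Lemma extends_continuously_bounded_below (g : C -> R) :
  extends_continuously_at_0 g -> bounded_below_near_0 g.
Proof.
intros [h [Hhg Hc]]; exists (h (RtoC 0) - 1).
assert (HP : locally (h (RtoC 0)) (fun y => h (RtoC 0) - 1 <= y)).
{ exists (mkposreal 1 Rlt_0_1); intros y Hy.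
  unfold ball in Hy; simpl in Hy; unfold AbsRing_ball, abs, minus, plus, opp in Hy; simpl in Hy.
  apply Rabs_lt_between in Hy; lra. }
specialize (Hc _ HP); unfold filtermap in Hc.
assert (H' : locally' (RtoC 0 : C_UniformSpace) (fun t => h (RtoC 0) - 1 <= h t)).
{ apply filter_imp with (2 := Hc); intros t Ht _; exact Ht. }
apply locally'_0_C in H'; destruct H' as [d [D H']].
apply locally'_0_C; exists (Rmin d 1); split; [apply Rmin_glb_lt; lra|].
intros t [Ht0 Ht]; apply Rmin_Rgt_l in Ht; destruct Ht.
rewrite <- Hhg; [apply H'; lra|unfold pdisk; lra].
Qed.

(** * The family of rational maps *)
Definition section_P1 (x : P1) : C * C :=
  match x with Fin z => (z, RtoC 1) | Infty => (RtoC 1, RtoC 0) end.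

Lemma section_P1_spec u : u <> C2_zero ->
  exists k, k <> RtoC 0 /\ u = C2_scal k (section_P1 (proj u)).
Proof.
destruct u as [z w]; intro Hu; unfold proj; simpl.
destruct (Ceq_dec w 0) as [->|Hw]; unfold C2_scal; simpl.
- exists z; split.
  + intros ->; apply Hu; reflexivity.
  + f_equal; ring.
- exists w; split; trivial. f_equal; field; trivial.
Qed.

Lemma proj_scal k u : k <> RtoC 0 -> proj (C2_scal k u) = proj u.
Proof.
intro Hk; destruct u as [z w]; unfold proj, C2_scal; simpl.
destruct (Ceq_dec w 0) as [->|Hw], (Ceq_dec (k * _) 0) as [H|H]; trivial.
- elim H; ring.
- elim (Cmult_neq_0 k w Hk Hw H).
- f_equal; field; auto.
Qed.

Definition rotation_family (lam t : C) (x : P1) : P1 := proj (rotation_map lam t (section_P1 x)).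

Lemma rotation_map_projects lam t : projects_to (rotation_map lam t) (rotation_family lam t).
Proof.
intros u Hu; unfold rotation_family.
destruct (section_P1_spec u Hu) as [k [Hk E]].
rewrite E at 2; rewrite rotation_map_scal, proj_scal; trivial.
apply Cmult_neq_0; trivial.
Qed.

Lemma rotation_map_nondegenerate lam t : Cmod lam = 1 -> pdisk t -> nondegenerate (rotation_map lam t).
Proof.
intros Hl Ht u; split.
- intro H; apply NNPP; intro Hu; revert H; apply rotation_map_nonzero; trivial; unfold pdisk in Ht; lra.
- intros ->; unfold rotation_map, C2_zero; simpl; f_equal; ring.
Qed.

(** Coefficients of z^i w^(2-i) in the two forms. *)
Definition rotation_p (lam : C) (i : nat) (t : C) : C :=
  match i with 0%nat => RtoC 0 | 1%nat => (- lam)%C | _ => lam end.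

Definition rotation_q (i : nat) (t : C) : C :=
  match i with 0%nat => (- RtoC 1)%C | 1%nat => RtoC 1 | _ => t end.

Lemma form_2 p u : form 2 p u =
  (p 0%nat * (snd u * snd u) + p 1%nat * (fst u * snd u) + p 2%nat * (fst u * fst u))%C.
Proof.
unfold form; rewrite !sum_Sn, sum_O; unfold plus; simpl; ring.
Qed.

Lemma rotation_map_form lam t u :
  form_map 2 (fun i => rotation_p lam i t) (fun i => rotation_q i t) u = rotation_map lam t u.
Proof.
unfold form_map; rewrite !form_2; unfold rotation_map; simpl; f_equal; ring.
Qed.

Lemma rotation_coefficients_holomorphic lam i t :
  C_ex_derive (rotation_p lam i) t /\ C_ex_derive (rotation_q i) t.
Proof.
destruct i as [|[|i]]; split.
- exact (C_ex_derive_const (RtoC 0) t).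
- exact (C_ex_derive_const (- RtoC 1)%C t).
- exact (C_ex_derive_const (- lam)%C t).
- exact (C_ex_derive_const (RtoC 1) t).
- exact (C_ex_derive_const lam t).
- exact (C_ex_derive_id t).
Qed.

Lemma nondegenerate_ext F F' : (forall u, F u = F' u) -> nondegenerate F' -> nondegenerate F.
Proof. intros E H u; rewrite E; apply H. Qed.

Lemma projects_to_ext F F' phi : (forall u, F u = F' u) -> projects_to F' phi -> projects_to F phi.
Proof. intros E H u Hu; rewrite E; apply H, Hu. Qed.

Lemma rotation_family_meromorphic lam : Cmod lam = 1 -> meromorphic_family 2 (rotation_family lam).
Proof.
intro Hl; exists (rotation_p lam), rotation_q; split.
- assert (Hc : forall c : C -> C, (forall t, C_ex_derive c t) -> meromorphic_at_0 c).
  { intros c Hc; split; [intros t _; apply Hc|].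
    exists 0%nat, c; split; [intros t _; apply Hc|]. intros t _; simpl; ring. }
  intros i _; split; apply Hc; intro t; apply (rotation_coefficients_holomorphic lam i t).
- intros t Ht; split.
  + apply nondegenerate_ext with (rotation_map lam t);
     [apply rotation_map_form|apply rotation_map_nondegenerate; trivial].
  + apply projects_to_ext with (rotation_map lam t);
     [apply rotation_map_form|apply rotation_map_projects].
Qed.

Lemma rotation_family_lift lam : Cmod lam = 1 ->
  family_lift 2 (rotation_family lam)
    (fun t => form_map 2 (fun i => rotation_p lam i t) (fun i => rotation_q i t)).
Proof.
intro Hl; exists (rotation_p lam), rotation_q; split; [|split; [reflexivity|]].
- intros i _; split; intros t _; apply (rotation_coefficients_holomorphic lam i t).
- intros t Ht; split.
  + apply nondegenerate_ext with (rotation_map lam t);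
     [apply rotation_map_form|apply rotation_map_nondegenerate; trivial].
  + apply projects_to_ext with (rotation_map lam t);
     [apply rotation_map_form|apply rotation_map_projects].
Qed.

(** * Independence of the lifts *)
Lemma proj_eq_cross u v : proj u = proj v -> (fst u * snd v = fst v * snd u)%C.
Proof.
destruct u as [a b], v as [c d]; unfold proj; simpl.
destruct (Ceq_dec b 0) as [->|Hb], (Ceq_dec d 0) as [->|Hd]; try discriminate.
- intros _; ring.
- intro H; assert (E : (a / b = c / d)%C) by exact (f_equal chart H).
  transitivity (a / b * b * d)%C; [field; trivial|rewrite E; field; trivial].
Qed.

(** The two forms of the family are coprime, so any pair of quadratic forms
    inducing the same rational map is a multiple of them.  As the coefficient of z^2 in the
    first form is the constant lam, the multiple is p_2 / lam, which depends
    holomorphically on t. *)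
Lemma rotation_lift_unique lam t p q : lam <> RtoC 0 -> t <> RtoC 0 ->
  projects_to (form_map 2 p q) (rotation_family lam t) ->
  forall u, form_map 2 p q u = C2_scal (p 2%nat / lam) (rotation_map lam t u).
Proof.
intros Hl Ht Hproj.
assert (Hcross : forall z w : C, (z, w) <> C2_zero ->
   (form 2 p (z, w) * snd (rotation_map lam t (z, w)) =
    fst (rotation_map lam t (z, w)) * form 2 q (z, w))%C).
{ intros z w Hu; apply (proj_eq_cross (form_map 2 p q (z, w))).
  rewrite <- (Hproj _ Hu); apply rotation_map_projects, Hu. }
set (h := (p 2%nat / lam)%C).
assert (Hp2 : p 2%nat = (h * lam)%C) by (unfold h; field; trivial).
clearbody h.
assert (H10 : RtoC 1 <> RtoC 0) by (intros [= H]; lra).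
(* At (0, 1) and (1, 1) the first form of the family vanishes and the second does not. *)
assert (E1 := Hcross (RtoC 0) (RtoC 1) ltac:(intros [= H]; lra)).
assert (E2 := Hcross (RtoC 1) (RtoC 1) ltac:(intros [= H]; lra)).
rewrite !form_2 in E1, E2; unfold rotation_map in E1, E2; simpl fst in E1, E2; simpl snd in E1, E2.
assert (Hp0 : p 0%nat = RtoC 0).
{ transitivity (- ((p 0%nat * (1 * 1) + p 1%nat * (0 * 1) + p 2%nat * (0 * 0)) *
      (1 * (0 - 1) + t * (0 * 0))))%C; [ring|rewrite E1; ring]. }
assert (Hp1 : p 1%nat = (- (h * lam))%C).
{ rewrite Hp0, Hp2 in E2.
  assert (E : ((p 1%nat + h * lam) * t = 0)%C).
  { transitivity ((0 * (1 * 1) + p 1%nat * (1 * 1) + h * lam * (1 * 1)) *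
      (1 * (1 - 1) + t * (1 * 1)))%C; [ring|rewrite E2; ring]. }
  destruct (Ceq_dec (p 1%nat + h * lam)%C 0) as [E0|E0].
  - transitivity ((p 1%nat + h * lam) - h * lam)%C; [ring|rewrite E0; ring].
  - elim (Cmult_neq_0 _ _ E0 Ht E). }
(* Where the first form is not zero the second coefficient is forced as well; three
   such points determine q. *)
assert (Hq : forall z w : C, (z <> 0 -> z - w <> 0 -> form 2 q (z, w) = h * (w * (z - w) + t * (z * z)))%C).
{ intros z w Hz Hzw.
  assert (E := Hcross z w ltac:(intros [= H _]; auto)).
  rewrite (form_2 p), Hp0, Hp1, Hp2 in E; unfold rotation_map in E; simpl fst in E; simpl snd in E.
  assert (Hc : (lam * (z * (z - w)) <> 0)%C) by (repeat apply Cmult_neq_0; trivial).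
  transitivity ((lam * (z * (z - w)) * form 2 q (z, w)) / (lam * (z * (z - w))))%C.
  - field; auto.
  - rewrite <- E; field; auto. }
assert (Q1 := Hq (RtoC 1) (RtoC 0)). assert (Q2 := Hq (RtoC 1) (- RtoC 1)%C).
assert (Q3 := Hq (RtoC 2) (RtoC 1)).
rewrite form_2 in Q1, Q2, Q3; simpl fst in Q1, Q2, Q3; simpl snd in Q1, Q2, Q3.
specialize (Q1 H10 ltac:(intros [= H]; lra)).
specialize (Q2 H10 ltac:(intros [= H]; lra)).
specialize (Q3 ltac:(intros [= H]; lra) ltac:(intros [= H]; lra)).
assert (Hq2 : q 2%nat = (h * t)%C).
{ transitivity (q 0%nat * (0 * 0) + q 1%nat * (1 * 0) + q 2%nat * (1 * 1))%C; [ring|rewrite Q1; ring]. }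
rewrite Hq2 in Q2, Q3.
assert (S2 : (q 0%nat - q 1%nat = - 2 * h)%C).
{ transitivity ((q 0%nat * (- (1) * - (1)) + q 1%nat * (1 * - (1)) + h * t * (1 * 1)) - h * t)%C;
   [ring|rewrite Q2; ring]. }
assert (S3 : (q 0%nat + 2 * q 1%nat = h)%C).
{ transitivity ((q 0%nat * (1 * 1) + q 1%nat * (2 * 1) + h * t * (2 * 2)) - 4 * h * t)%C;
   [ring|rewrite Q3; ring]. }
assert (H3 : RtoC 3 <> RtoC 0) by (intros [= H]; lra).
assert (Hq1 : q 1%nat = h).
{ transitivity (((q 0%nat + 2 * q 1%nat) - (q 0%nat - q 1%nat)) / 3)%C; [field; trivial|].
  rewrite S2, S3; field; trivial. }
assert (Hq0 : q 0%nat = (- h)%C).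
{ transitivity ((q 0%nat - q 1%nat) + q 1%nat)%C; [ring|rewrite S2, Hq1; ring]. }
intro u; unfold form_map; rewrite !form_2, Hp0, Hp1, Hp2, Hq0, Hq1, Hq2.
unfold C2_scal, rotation_map; simpl; f_equal; ring.
Qed.

Fixpoint lift_scale (h c : C) (n : nat) : C :=
  match n with O => c | S n => (h * (lift_scale h c n * lift_scale h c n))%C end.

Lemma scaled_orbit lam t h c (F : C * C -> C * C) n :
  (forall u, F u = C2_scal h (rotation_map lam t u)) ->
  Nat.iter n F (C2_scal c (lam, RtoC 1)) = C2_scal (lift_scale h c n) (rotation_orbit lam t n).
Proof.
intros HF; induction n; [reflexivity|].
change (Nat.iter (S n) F (C2_scal c (lam, RtoC 1))) with (F (Nat.iter n F (C2_scal c (lam, RtoC 1)))).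
rewrite IHn, HF, rotation_map_scal; unfold C2_scal; simpl; f_equal; ring.
Qed.

Lemma lift_scale_nonzero h c n : h <> RtoC 0 -> c <> RtoC 0 -> lift_scale h c n <> RtoC 0.
Proof. intros Hh Hc; induction n; simpl; trivial; repeat apply Cmult_neq_0; trivial. Qed.

Lemma ln_lift_scale h c n : h <> RtoC 0 -> c <> RtoC 0 ->
  ln (Cmod (lift_scale h c n)) = (2 ^ n - 1) * ln (Cmod h) + 2 ^ n * ln (Cmod c).
Proof.
intros Hh Hc; induction n; [simpl; ring|].
assert (Hn := lift_scale_nonzero h c n Hh Hc).
apply Cmod_gt_0 in Hn. assert (Hh' := proj1 (Cmod_gt_0 h) Hh).
simpl lift_scale; rewrite !Cmod_mult, !ln_mult, IHn; trivial; [simpl; ring|].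
apply Rmult_lt_0_compat; trivial.
Qed.

(** The n-th iterates differ by the factor h^(2^n - 1) c^(2^n), by homogeneity. *)
Lemma escape_rate_of_lift lam t h c F G : Cmod lam = 1 -> pdisk t ->
  h <> RtoC 0 -> c <> RtoC 0 ->
  (forall u, F u = C2_scal h (rotation_map lam t u)) ->
  is_escape_rate 2 F (C2_scal c (lam, RtoC 1)) G <->
  G = rotation_escape lam t + ln (Cmod h) + ln (Cmod c).
Proof.
intros Hl Ht Hh Hc HF; unfold pdisk in Ht.
assert (Hscale := fun n => lift_scale_nonzero h c n Hh Hc).
assert (Horb := fun n => rotation_orbit_nonzero lam t n Hl ltac:(lra)).
destruct (rotation_escape_spec lam t Hl ltac:(lra)) as [Hlim _].
assert (Hpow : forall n, 2 ^ n <> 0) by (intro n; apply pow_nonzero; lra).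
rewrite escape_rate_max_norm; [|lia|].
- assert (Hlim' : is_lim_seq (fun n => ln (max_norm (Nat.iter n F (C2_scal c (lam, RtoC 1)))) / INR 2 ^ n)
    (rotation_escape lam t + ln (Cmod h) + ln (Cmod c))).
  { apply is_lim_seq_ext with (fun n => ln (max_norm (rotation_orbit lam t n)) / 2 ^ n +
       (1 - (/ 2) ^ n) * ln (Cmod h) + ln (Cmod c)).
    - intro n; rewrite (scaled_orbit lam t h), max_norm_scal, ln_mult, ln_lift_scale; trivial.
      + rewrite pow_inv; change (INR 2) with 2; field; apply Hpow.
      + apply Cmod_gt_0, Hscale.
      + apply max_norm_pos, Horb.
    - apply is_lim_seq_plus'; [apply is_lim_seq_plus'; [exact Hlim|]|apply is_lim_seq_const].
      replace (Finite (ln (Cmod h))) with (Finite ((1 - 0) * ln (Cmod h))) by (f_equal; ring).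
      apply is_lim_seq_mult'; [|apply is_lim_seq_const].
      apply is_lim_seq_minus'; [apply is_lim_seq_const|].
      apply is_lim_seq_geom; rewrite Rabs_pos_eq; lra. }
  split.
  + intro H; assert (E := is_lim_seq_unique _ _ H); rewrite (is_lim_seq_unique _ _ Hlim') in E.
    now injection E.
  + intros ->; exact Hlim'.
- intro n; rewrite (scaled_orbit lam t h) by trivial; apply max_norm_pos.
  rewrite max_norm_scal; apply Rmult_lt_0_compat; [apply Cmod_gt_0, Hscale|apply max_norm_pos, Horb].
Qed.

Lemma nonvanishing_ln_bounded (c : C -> C) : C_ex_derive c (RtoC 0) -> c (RtoC 0) <> RtoC 0 ->
  exists B del, 0 < del /\ forall t, Cmod t < del -> Rabs (ln (Cmod (c t))) <= B.
Proof.
intros Hd Hc; assert (HM := proj1 (Cmod_gt_0 _) Hc); set (M := Cmod (c (RtoC 0))) in *.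
destruct (C_ex_derive_eps_continuous c _ Hd (M / 2)) as [del [Hdel H]]; [lra|].
exists (Rmax (Rabs (ln (M / 2))) (Rabs (ln (2 * M)))), del; split; trivial.
intros t Ht; specialize (H t); replace (t - 0)%C with t in H by ring; specialize (H Ht).
assert (H' := Rle_lt_trans _ _ _ (Cmod_lipschitz _ _) H); fold M in H'.
apply Rabs_lt_between in H'.
assert (L1 : ln (M / 2) <= ln (Cmod (c t))) by (apply ln_le; lra).
assert (L2 : ln (Cmod (c t)) <= ln (2 * M)) by (apply ln_le; lra).
generalize (Rmax_l (Rabs (ln (M / 2))) (Rabs (ln (2 * M)))) (Rmax_r (Rabs (ln (M / 2))) (Rabs (ln (2 * M))))
 (Rle_abs (ln (2 * M))) (Rle_abs (- ln (M / 2))); rewrite Rabs_Ropp; intros.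
apply Rabs_le; lra.
Qed.

(** Every admissible g comes from the lifts h F and c (lam, 1). *)
Lemma is_g_normal_form lam g : Cmod lam = 1 ->
  is_g 2 (rotation_family lam) (fun _ => Fin lam) g ->
  exists (h c : C -> C) (eta : R),
    holomorphic_on disk h /\ (forall t, pdisk t -> h t <> RtoC 0) /\
    holomorphic_on disk c /\ (forall t, disk t -> c t <> RtoC 0) /\
    (forall t, pdisk t ->
       g t + eta * ln (Cmod t) = rotation_escape lam t + ln (Cmod (h t)) + ln (Cmod (c t))) /\
    (forall eps, 0 < eps -> exists del, 0 < del /\ forall t, 0 < Cmod t < del ->
       Rabs (g t) <= eps * Rabs (ln (Cmod t))).
Proof.
intros Hl [F [b [eta [[p [q [Hpq [HF HFt]]]] [[_ [Hb2 Hb]] [Hesc Hdom]]]]]].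
assert (Hlam : lam <> RtoC 0) by (apply Cmod_gt_0; lra).
exists (fun t => p 2%nat t / lam)%C, (fun t => snd (b t)), eta.
assert (HFh : forall t, pdisk t -> forall u, F t u = C2_scal (p 2%nat t / lam) (rotation_map lam t u)).
{ intros t Ht u; rewrite HF; apply (rotation_lift_unique lam t (fun i => p i t) (fun i => q i t)); trivial.
  - apply Cmod_gt_0, Ht.
  - rewrite <- HF; apply HFt, Ht. }
assert (Hh0 : forall t, pdisk t -> (p 2%nat t / lam)%C <> RtoC 0).
{ intros t Ht Hz.
  destruct (HFt t Ht) as [Hnd _].
  assert (E : F t (RtoC 1, RtoC 0) = C2_zero).
  { rewrite HFh, Hz by trivial; unfold C2_scal, C2_zero; f_equal; ring. }
  apply (proj1 (Hnd _)) in E; revert E; intros [= E]; lra. }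
assert (Hbt : forall t, disk t -> snd (b t) <> RtoC 0 /\ b t = C2_scal (snd (b t)) (lam, RtoC 1)).
{ intros t Ht; destruct (Hb t Ht) as [_ Hp]; revert Hp; unfold proj.
  destruct (Ceq_dec (snd (b t)) 0) as [H|H]; [discriminate|].
  intro Hp; assert (E : (fst (b t) / snd (b t))%C = lam) by exact (f_equal chart Hp).
  split; trivial.
  rewrite <- E; unfold C2_scal; simpl; destruct (b t) as [z w]; simpl in *; f_equal; field; trivial. }
split; [|split; [|split; [|split; [|split]]]]; trivial.
- intros t Ht; apply C_ex_derive_mult; [apply (Hpq 2%nat (le_n _)), Ht|apply C_ex_derive_const].
- intros t Ht; apply Hbt, Ht.
- intros t Ht; assert (Htd : disk t) by (unfold disk, pdisk in *; lra).
  destruct (Hbt t Htd) as [Hs E].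
  apply (escape_rate_of_lift lam t _ (snd (b t)) (F t)); auto.
  rewrite <- E; apply Hesc, Ht.
- intros eps Heps; apply locally'_0_C; exact (Hdom (mkposreal eps Heps)).
Qed.

Lemma ln_minus_infty K : exists del, 0 < del <= 1 /\ forall t, 0 < Cmod t < del -> ln (Cmod t) < - K.
Proof.
exists (Rmin 1 (exp (- K))); split.
- split; [apply Rmin_glb_lt; [lra|apply exp_pos]|apply Rmin_l].
- intros t [Ht0 Ht]; apply Rmin_Rgt_l in Ht; rewrite <- (ln_exp (- K)); apply ln_increasing; lra.
Qed.

(** Both g and G are o(log |t|) and log |c| is bounded, so |h| <= |t|^(eta - eps) near 0
    for each eps.  By [growth_at_puncture], log |h| - eta log |t| is then bounded
    above, hence so is g - G. *)
Lemma every_g_minus_infty lam g : liouville_multiplier lam ->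
  is_g 2 (rotation_family lam) (fun _ => Fin lam) g ->
  forall K, exists del, 0 < del /\ forall t, 0 < Cmod t < del -> g t <= - K.
Proof.
intros Hlam Hg K; assert (Hl := proj1 Hlam).
destruct (is_g_normal_form lam g Hl Hg) as [h [c [eta [Hh [Hh0 [Hc [Hc0 [Heq Hsmall]]]]]]]].
assert (D0 : disk (RtoC 0)) by (unfold disk; rewrite Cmod_0; lra).
destruct (nonvanishing_ln_bounded c (Hc _ D0) (Hc0 _ D0)) as [B [d1 [D1 HB]]].
assert (B0 : 0 <= B).
{ apply Rle_trans with (Rabs (ln (Cmod (c (RtoC 0))))); [apply Rabs_pos|apply HB; rewrite Cmod_0; trivial]. }
destruct (growth_at_puncture h eta) as [A [HA Hgrow]].
{ intros t Ht; apply Hh; unfold disk, pdisk in *; lra. }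
{ intros eps Heps.
  assert (He : 0 < eps / 4) by lra.
  destruct (Hsmall _ He) as [d2 [D2 H2]].
  destruct (rotation_escape_little_o lam Hlam _ He) as [d3 [D3 H3]].
  destruct (ln_minus_infty (4 * B / eps)) as [d4 [D4 H4]].
  exists (Rmin (Rmin d1 d2) (Rmin d3 d4)); split.
  { repeat apply Rmin_glb_lt; lra. }
  intros t [Ht0 Ht]; apply Rmin_Rgt_l in Ht; destruct Ht as [Ha Hb].
  apply Rmin_Rgt_l in Ha; apply Rmin_Rgt_l in Hb; destruct Ha as [T1 T2], Hb as [T3 T4].
  assert (Ht : pdisk t) by (unfold pdisk; lra).
  specialize (HB t T1); specialize (H2 t ltac:(lra)); specialize (H3 t ltac:(lra)).
  specialize (H4 t ltac:(lra)); specialize (Heq t Ht).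
  assert (Hneg : ln (Cmod t) < 0) by (rewrite <- ln_1; apply ln_increasing; lra).
  rewrite (Rabs_left (ln (Cmod t))) in H2, H3 by trivial.
  apply Rabs_le_between in HB; apply Rabs_le_between in H2; apply Rabs_le_between in H3.
  assert (HBe : B < eps / 4 * - ln (Cmod t)).
  { replace B with (eps / 4 * (4 * B / eps)) by (field; lra). apply Rmult_lt_compat_l; lra. }
  assert (Hhp : 0 < Cmod (h t)) by (apply Cmod_gt_0, Hh0, Ht).
  rewrite <- (exp_ln (Cmod (h t))) by trivial.
  assert (ln (Cmod (h t)) <= (eta - eps) * ln (Cmod t)) as [H|H] by nra.
  - apply Rlt_le, exp_increasing, H.
  - rewrite H; lra. }
destruct (rotation_escape_minus_infty lam Hlam (K + ln A + B)) as [d2 [D2 H2]].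
exists (Rmin (Rmin d1 d2) (exp (-1))); split.
{ repeat apply Rmin_glb_lt; trivial; apply exp_pos. }
intros t [Ht0 Ht]; apply Rmin_Rgt_l in Ht; destruct Ht as [Ht T3].
apply Rmin_Rgt_l in Ht; destruct Ht as [T1 T2].
assert (exp (-1) < 1) by (rewrite <- exp_0; apply exp_increasing; lra).
assert (Ht : pdisk t) by (unfold pdisk; lra).
specialize (HB t T1); specialize (H2 t ltac:(lra)); specialize (Hgrow t ltac:(lra)); specialize (Heq t Ht).
apply Rabs_le_between in HB.
assert (Hhp : 0 < Cmod (h t)) by (apply Cmod_gt_0, Hh0, Ht).
apply ln_le in Hgrow; trivial.
rewrite ln_mult, ln_exp in Hgrow by (trivial; apply exp_pos).
lra.
Qed.

Lemma rotation_escape_is_g lam : liouville_multiplier lam ->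
  is_g 2 (rotation_family lam) (fun _ => Fin lam) (rotation_escape lam).
Proof.
intros Hlam; assert (Hl := proj1 Hlam).
assert (H10 : RtoC 1 <> RtoC 0) by (intros [= H]; lra).
exists (fun t => form_map 2 (fun i => rotation_p lam i t) (fun i => rotation_q i t)),
  (fun _ => (lam, RtoC 1)), 0.
split; [apply rotation_family_lift, Hl|].
split; [|split].
- split; [intros t _; apply C_ex_derive_const|split; [intros t _; apply C_ex_derive_const|]].
  intros t _; split.
  + intros [= _ H]; lra.
  + unfold proj; simpl; destruct (Ceq_dec 1 0) as [H|H]; [elim (H10 H)|].
    f_equal; field.
- intros t Ht.
  replace (lam, RtoC 1) with (C2_scal 1 (lam, RtoC 1)) by (unfold C2_scal; simpl; f_equal; ring).
  apply (escape_rate_of_lift lam t 1 1); trivial.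
  + intro u; rewrite rotation_map_form; unfold C2_scal; destruct (rotation_map lam t u); simpl; f_equal; ring.
  + rewrite Cmod_1, ln_1; ring.
- intros eps; apply locally'_0_C.
  exact (rotation_escape_little_o lam Hlam eps (cond_pos eps)).
Qed.

(** * The counterexample *)
Theorem mainTheorem2 :
  exists (d : nat) (f : C -> P1 -> P1) (a : C -> P1),
    (1 < d)%nat /\ meromorphic_family d f /\ holomorphic_P1 a /\
    (exists g : C -> R, is_g d f a g) /\
    (forall g : C -> R, is_g d f a g ->
       limsup (locally' (RtoC 0 : C_UniformSpace)) g = m_infty /\
       ~ bounded_below_near_0 g /\
       ~ extends_continuously_at_0 g).
Proof.
destruct exists_liouville_multiplier as [lam Hlam].
assert (Hl := proj1 Hlam).
exists 2%nat, (rotation_family lam), (fun _ => Fin lam).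
split; [lia|split; [|split; [|split]]].
- apply rotation_family_meromorphic, Hl.
- intros t _; left; split; [|apply C_ex_derive_const].
  apply filter_forall; intros s; discriminate.
- exists (rotation_escape lam); apply rotation_escape_is_g, Hlam.
- intros g Hg; assert (H := every_g_minus_infty lam g Hlam Hg).
  assert (Hnb := tends_to_m_infty_not_bounded g H).
  split; [|split]; trivial.
  + apply limsup_m_infty; intro K; apply locally'_0_C, H.
  + intro He; apply Hnb, extends_continuously_bounded_below, He.
Qed.
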